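(* Let $p>0$ not be an even integer. Then there is full $p$-concentration for the class $\mathcal{P}^+$ for measurable sets, and the concentrating positive definite trigonometric polynomials can be chosen with arbitrarily large gaps: for every $\gamma<1$, every symmetric measurable set $E\subset\mathbb{T}$ of positive measure and every $N>0$ there is $f\in\mathcal{P}^+$ with gaps larger than $N$ such that $\int_E|f|^p\ge\gamma\int_{\mathbb{T}}|f|^p$.
   Context: $\mathbb{T}=\mathbb{R}/\mathbb{Z}$ with Lebesgue measure of total mass $1$; $e(t)=e^{2\pi i t}$; $\mathbb{N}$ denotes the nonnegative integers. $\mathcal{P}^+$ is the set of functions $f(x)=\sum_{h\in H}a_h e(hx)$ on $\mathbb{T}$ with $H\subset\mathbb{N}$ finite and nonempty and $a_h>0$ for all $h\in H$. Such an $f$ has gaps larger than $N$ if consecutive elements of $H$ (in increasing order) differ by more than $N$. A set $E\subset\mathbb{T}$ is symmetric if $x\in E$ implies $-x\in E$. *)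

(* Defs.v *)
From HB Require Import structures.
From mathcomp Require Import all_boot all_order all_algebra finmap.
From mathcomp Require Import all_classical all_reals all_analysis.
From mathcomp Require Import complex.

Set Implicit Arguments.
Unset Strict Implicit.
Unset Printing Implicit Defensive.

Import Order.TTheory GRing.Theory Num.Theory.
Import numFieldNormedType.Exports.

Local Open Scope classical_set_scope.
Local Open Scope ring_scope.

(* Subsets of the circle R/Z are represented by 1-periodic subsets of R, and
   functions on the circle by 1-periodic functions on R. *)
Definition circle_set (R : realType) (E : set R) : Prop :=
  forall x, E (x + 1) <-> E x.

Definition symmetric_set (R : realType) (E : set R) : Prop :=
  forall x, E x -> E (- x).

(* Lebesgue (not merely Borel) measurability: Caratheodory's criterion for the
   Lebesgue outer measure, i.e. the sigma-algebra on which
   completed_lebesgue_measure is a measure. *)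
Definition lebesgue_measurable (R : realType) (E : set R) : Prop :=
  ((wlength (@idfun R))^*)%mu.-cara.-measurable E.

(* The normalized measure and the integral on R/Z, computed on the fundamental
   domain [0, 1). *)
Definition circle_measure (R : realType) (E : set R) : \bar R :=
  completed_lebesgue_measure (E `&` `[0, 1[).

Definition circle_integral (R : realType) (E : set R) (g : R -> R) : \bar R :=
  (\int[@completed_lebesgue_measure R]_(x in E `&` `[0%R, 1%R[) (g x)%:E)%E.

Definition expi2pi (R : realType) (t : R) : R[i] :=
  Complex (cos (2 * pi * t)) (sin (2 * pi * t)).

Definition trigpoly (R : realType) (H : {fset nat}) (a : nat -> R) (x : R) :
    R[i] :=
  \sum_(h <- H) real_complex R (a h) * expi2pi (h%:R * x).

Definition posdef_expansion (R : realType) (H : {fset nat}) (a : nat -> R)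
    (f : R -> R[i]) : Prop :=
  [/\ H != fset0, forall h, h \in H -> 0 < a h
    & forall x, f x = trigpoly H a x].

Definition Pplus (R : realType) : set (R -> R[i]) :=
  [set f | exists (H : {fset nat}) (a : nat -> R), posdef_expansion H a f].

Definition consecutive (H : {fset nat}) (h k : nat) : Prop :=
  [/\ h \in H, k \in H, (h < k)%N & forall j, j \in H -> ~~ (h < j < k)%N].

(* H is determined by f, the coefficients being nonzero and the characters
   linearly independent, so the existential over H involves no choice. *)
Definition gaps_larger_than (R : realType) (N : R) (f : R -> R[i]) : Prop :=
  exists (H : {fset nat}) (a : nat -> R), posdef_expansion H a f /\
    forall h k, consecutive H h k -> N < k%:R - h%:R.

(* Main.v *)
Require Import Defs.
From HB Require Import structures.
From mathcomp Require Import all_boot all_order all_algebra finmap.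
From mathcomp Require Import all_classical all_reals all_analysis.
From mathcomp Require Import complex.
From mathcomp Require Import measurable_realfun zify ring lra.
Import Order.TTheory GRing.Theory Num.Theory.
Import numFieldNormedType.Exports.
Local Open Scope classical_set_scope.
Local Open Scope ring_scope.

Set Implicit Arguments.
Unset Strict Implicit.
Unset Printing Implicit Defensive.

(* Call a function w a weight if int h |f|^p w > 0, for a bounded measurable h
   and an f in P^+ with gaps, always implies int h |g|^p > 0 for some g in P^+
   with gaps; the theorem is int h |g|^p > 0 for h = 1_S - gamma, S a Borel part
   of E.  Weights are stable under products, positive scalings and bounded
   pointwise limits.  By Fejer's lemma, multiplying f by
   (1 + a e(m x)) (1 + b e((n + K m) x)) and letting m tend to infinity, so that
   the gaps survive when K >= 2, shows that
     M_b(x) = int |1 + a e(y)|^p |1 + b e(n x + K y)|^p dy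
   is a weight.  To first order in b it is d_0 + p b d_K cos(2 pi n x), where d_K
   is the K-th cosine coefficient of |1 + a e(y)|^p.  The d_K satisfy a three-term
   recurrence whose coefficients are eventually positive, and nonzero because p is
   not an even integer; hence d_K takes both signs for large K.  Powers of M_b with
   b -> 0 therefore yield the weights exp(t cos(2 pi n x)) for every real t, then
   exp(- k ((cos(2 pi x) - c) / s)^(2 k)), and finally the indicator of
   |cos(2 pi x) - c| < s, that is of an interval and its mirror image.  Such a pair
   around a density point of S makes int h w positive. *)

(** * Means over the unit interval *)

Section unit_interval.
Context {R : realType}.
Implicit Types (F G : R -> R) (c x : R).
Local Notation mu := (@lebesgue_measure R).

(* Bounded on [0, 1] only, so that every continuous function qualifies. *)
Definition bounded_measurable F : Prop :=
  measurable_fun [set: R] F /\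
  exists C : R, forall x, 0 <= x <= 1 -> `|F x| <= C.

(** Adding the end point 1 to the fundamental domain changes no integral and makes the domain
    compact. *)
Definition mean F : R := \int[mu]_(x in `[0, 1]) F x.

Lemma bounded_measurable_integrable F :
  bounded_measurable F -> mu.-integrable `[0, 1] (EFin \o F).
Proof.
move=> [mF [C FC]]; apply: measurable_bounded_integrable => //=.
- by rewrite lebesgue_measure_itv/= lte_fin ltr01 oppr0 addr0 ltry.
- exact: measurable_funTS.
- exists C; split; first exact: num_real.
  move=> y Cy x /=; rewrite in_itv/= => x01.
  by rewrite (le_trans (FC _ x01))// ltW.
Qed.

Lemma bounded_measurable_cst c : bounded_measurable (fun=> c).
Proof. by split; [exact: measurable_cst|exists `|c|]. Qed.

Lemma bounded_measurable_indic (A : set R) : measurable A ->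
  bounded_measurable \1_A.
Proof.
move=> mA; split; first exact: measurable_indic.
by exists 1 => x _; rewrite indicE; case: (_ \in _); rewrite ?normr1 ?normr0.
Qed.

Lemma bounded_measurableD F G : bounded_measurable F -> bounded_measurable G ->
  bounded_measurable (fun x => F x + G x).
Proof.
move=> [mF [C FC]] [mG [D GD]]; split; first exact: measurable_funD.
exists (C + D) => x x01.
by rewrite (le_trans (ler_normD _ _))// lerD ?FC ?GD.
Qed.

Lemma bounded_measurableM F G : bounded_measurable F -> bounded_measurable G ->
  bounded_measurable (fun x => F x * G x).
Proof.
move=> [mF [C FC]] [mG [D GD]]; split; first exact: measurable_funM.
by exists (C * D) => x x01; rewrite normrM ler_pM ?FC ?GD.
Qed.

Lemma bounded_measurableZ c F : bounded_measurable F ->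
  bounded_measurable (fun x => c * F x).
Proof. exact/bounded_measurableM/bounded_measurable_cst. Qed.

Lemma bounded_measurableB F G : bounded_measurable F -> bounded_measurable G ->
  bounded_measurable (fun x => F x - G x).
Proof.
move=> bF bG; have := bounded_measurableD bF (bounded_measurableZ (-1) bG).
by congr bounded_measurable; apply/funext => x; rewrite mulN1r.
Qed.

Lemma bounded_measurable_norm F : bounded_measurable F ->
  bounded_measurable (fun x => `|F x|).
Proof.
move=> [mF [C FC]]; split; first exact: measurableT_comp.
by exists C => x x01; rewrite normr_id FC.
Qed.

Lemma continuous_bounded_measurable F : continuous F -> bounded_measurable F.
Proof.
move=> cF; split; first exact: continuous_measurable_fun.
have /compact_bounded[M [_ FM]] : compact (F @` `[0, 1]).
  by apply: continuous_compact; [exact: continuous_subspaceT|exact: segment_compact].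
exists (M + 1) => x x01; apply: FM; first by rewrite ltrDl.
by exists x => //=; rewrite in_itv.
Qed.

Lemma continuous_scale F c : continuous F -> continuous (fun x => F (c * x)).
Proof.
by move=> cF x; exact: (continuous_comp (@mulrl_continuous _ c x) (cF (c * x))).
Qed.

Lemma eq_mean F G : (forall x, 0 <= x <= 1 -> F x = G x) -> mean F = mean G.
Proof. by move=> FG; apply: eq_Rintegral => x; rewrite inE/= in_itv/= => /FG. Qed.

Lemma meanD F G : bounded_measurable F -> bounded_measurable G ->
  mean (fun x => F x + G x) = mean F + mean G.
Proof.
by move=> bF bG; apply: RintegralD => //; exact: bounded_measurable_integrable.
Qed.

Lemma meanB F G : bounded_measurable F -> bounded_measurable G ->
  mean (fun x => F x - G x) = mean F - mean G.
Proof.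
by move=> bF bG; apply: RintegralB => //; exact: bounded_measurable_integrable.
Qed.

Lemma meanZ c F : bounded_measurable F -> mean (fun x => c * F x) = c * mean F.
Proof.
by move=> bF; apply: RintegralZl => //; exact: bounded_measurable_integrable.
Qed.

Lemma mean_cst c : mean (fun=> c) = c.
Proof.
rewrite /mean Rintegral_cst//= lebesgue_measure_itv/= lte_fin ltr01.
by rewrite oppr0 addr0/= mulr1.
Qed.

Lemma ler_mean F G : bounded_measurable F -> bounded_measurable G ->
  (forall x, 0 <= x <= 1 -> F x <= G x) -> mean F <= mean G.
Proof.
move=> bF bG FG.
apply: le_Rintegral => [//|||x /=]; try exact: bounded_measurable_integrable.
by rewrite in_itv/=; exact: FG.
Qed.

Lemma mean_ge0 F : (forall x, 0 <= x <= 1 -> 0 <= F x) -> 0 <= mean F.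
Proof.
by move=> F0; apply: Rintegral_ge0 => x; rewrite /= in_itv/=; exact: F0.
Qed.

Lemma ler_norm_mean F : bounded_measurable F -> `|mean F| <= mean (fun x => `|F x|).
Proof.
by move=> bF; apply: le_normr_Rintegral => //; exact: bounded_measurable_integrable.
Qed.

Lemma ler_norm_mean_le F c : bounded_measurable F ->
  (forall x, 0 <= x <= 1 -> `|F x| <= c) -> `|mean F| <= c.
Proof.
move=> bF Fc; rewrite (le_trans (ler_norm_mean bF))// -[leRHS]mean_cst.
apply: ler_mean => //; first exact: bounded_measurable_norm.
exact: bounded_measurable_cst.
Qed.

Lemma mean_cvg (F_ : nat -> R -> R) F (C : R) :
  (forall n, measurable_fun [set: R] (F_ n)) ->
  measurable_fun [set: R] F ->
  (forall n x, 0 <= x <= 1 -> `|F_ n x| <= C) ->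
  (forall x, 0 <= x <= 1 -> F_ n x @[n --> \oo] --> F x) ->
  mean (F_ n) @[n --> \oo] --> mean F.
Proof.
move=> mF_ mF F_C F_F.
have iC : mu.-integrable `[0, 1] (EFin \o cst C).
  exact/bounded_measurable_integrable/bounded_measurable_cst.
have [//||||//||iF _ cF] := @dominated_convergence _ _ _ mu `[0, 1] _
  (fun n => EFin \o F_ n) (EFin \o F) (EFin \o cst C).
- move=> n; apply/measurable_EFinP. by apply: measurable_funTS; exact: mF_.
- by apply/measurable_EFinP; exact: measurable_funTS.
- apply: aeW => x /=; rewrite in_itv/= => x01.
  by apply: cvg_EFin; [exact: nearW|exact: F_F].
- apply: aeW => x /= n; rewrite in_itv/= lee_fin; exact: F_C.
by apply: fine_cvg; rewrite fineK// integrable_fin_num.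
Qed.

(** Compactness enters as near-covering along [0^'+]: small radii work near each point, hence one
    works on the whole segment. Only [x] is confined to the segment; [y] may leave it. *)
Lemma uniformly_continuous_segment F (a b : R) : continuous F ->
  forall e, 0 < e -> exists2 d, 0 < d &
    forall x y, a <= x <= b -> `|x - y| < d -> `|F x - F y| < e.
Proof.
move=> cF e e0.
have e20 : 0 < e / 2 by rewrite divr_gt0.
have /compact_near_coveringP := @segment_compact R a b.
pose P (d x : R) := forall y, `|x - y| < d -> `|F x - F y| < e.
move=> /(_ R (0^'+) P _).
have FF : Filter (0 : R)^'+ by typeclasses eauto.
case.
  move=> x _.
  have /cvgrPdist_lt/(_ _ e20)[d /= d0 Fd] := cF x.
  have d20 : 0 < d / 2 by rewrite divr_gt0.
  exists (ball x (d / 2), [set r | 0 < r < d / 2]) => /=.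
    split; first exact: nbhsx_ballx.
    near=> r; apply/andP; split; near: r; [exact: nbhs_right_gt|exact: nbhs_right_lt].
  move=> [z r] /= [xz /andP[r0 rd]] y zy.
  rewrite /ball/= in xz.
  have -> : F z - F y = (F x - F y) - (F x - F z) by ring.
  rewrite (le_lt_trans (ler_normB _ _))// [e]splitr ltrD//; apply: Fd => /=.
    have -> : x - y = (x - z) + (z - y) by ring.
    rewrite (le_lt_trans (ler_normD _ _))// [d]splitr ltrD//.
    exact: (lt_trans zy).
  by rewrite (lt_le_trans xz)//; move: d0; rewrite /=; lra.
move=> d /= d0 Pd; exists (d / 2); first by rewrite divr_gt0.
move=> x y xab xy; apply: (Pd (d / 2)) => //=.
- by rewrite sub0r normrN gtr0_norm ?divr_gt0// ltr_pdivrMr// ltr_pMr// ltr1n.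
- by rewrite divr_gt0.
Unshelve. all: by end_near. Qed.

End unit_interval.

(** * Fourier coefficients of the kernel *)

Section mean_calculus.
Context {R : realType}.
Implicit Types (F G f : R -> R).

Lemma mean_derive F f : (forall x : R, is_derive x (1 : R) F (f x)) -> continuous f ->
  mean f = F 1 - F 0.
Proof.
move=> Ff cf.
have dF (x : R) : derivable F x 1 by have [] := Ff x.
have cF : continuous F.
  by move=> x; apply/differentiable_continuous/derivable1_diffP.
rewrite /mean /Rintegral (@continuous_FTC2 _ f F)//=.
- exact: continuous_subspaceT.
- by split=> [x _ //||]; [exact: cvg_at_right_filter (cF _)|exact: cvg_at_left_filter (cF _)].
- by move=> x _; rewrite derive1E; have [_ ->] := Ff x.
Qed.

Lemma mean_onem F : continuous F -> mean F = mean (fun x => F (1 - x)).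
Proof.
move=> cF; rewrite /mean (@Rintegration_by_substitution_onem _ F 1) .
- by rewrite (_ : unstable.onem 1 = 0) // /unstable.onem subrr.
- by rewrite ler01 lexx.
- exact: continuous_subspaceT.
Qed.

Lemma mean_odd F : continuous F -> (forall x, F (1 - x) = - F x) -> mean F = 0.
Proof.
move=> cF F1; have := mean_onem cF.
rewrite (_ : (fun x => F (1 - x)) = fun x => (-1) * F x); last first.
  by apply/funext => x; rewrite F1 mulN1r.
rewrite meanZ; last exact: continuous_bounded_measurable.
lra.
Qed.

End mean_calculus.

Section powfactor.
Context {R : realType}.
Variable p : R.
Implicit Types (b t x y : R) (n : nat).

(* [|1 + b e(t)|^2] *)
Definition sqnorm b t : R := 1 + 2 * b * cos (2 * pi * t) + b ^+ 2.

(** This is [|1 + b e(t)|^p]; the exponent is halved because [sqnorm] is a squared modulus. *)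
Definition powfactor b t : R := sqnorm b t `^ (p / 2).

Lemma cos2pi_periodic n t : cos (2 * pi * (t + n%:R)) = cos (2 * pi * t) :> R.
Proof.
rewrite mulrDr (_ : 2 * pi * n%:R = (pi *+ 2) *+ n); last first.
  by rewrite -[RHS]mulr_natr -[pi *+ 2]mulr_natr; ring.
apply: (periodicn (@cosD2pi R)).
Qed.

Lemma sin2pi_periodic n t : sin (2 * pi * (t + n%:R)) = sin (2 * pi * t) :> R.
Proof.
rewrite mulrDr (_ : 2 * pi * n%:R = (pi *+ 2) *+ n); last first.
  by rewrite -[RHS]mulr_natr -[pi *+ 2]mulr_natr; ring.
apply: (periodicn (@sinD2pi R)).
Qed.

Lemma powfactor_periodic b n t : powfactor b (t + n%:R) = powfactor b t.
Proof. by rewrite /powfactor /sqnorm cos2pi_periodic. Qed.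

Lemma powfactorN b t : powfactor b (- t) = powfactor b t.
Proof. by rewrite /powfactor /sqnorm mulrN cosN. Qed.

(** [sqnorm b t] equals [(1 - b)^2 + 2 b (1 + cos (2 pi t))]. Positivity makes its real powers
    differentiable. *)
Lemma sqnorm_gt0 b t : 0 <= b < 1 -> 0 < sqnorm b t.
Proof.
move=> /andP[b0 b1].
have : 0 < (1 - b) ^+ 2 by rewrite exprn_gt0// subr_gt0.
have : 0 <= b * (1 + cos (2 * pi * t)).
  by rewrite mulr_ge0// -lerBlDl sub0r cos_geN1.
by rewrite /sqnorm; nra.
Qed.

Lemma powfactor_le b t : 0 <= p -> 0 <= b < 1 ->
  `|powfactor b t| <= ((1 + b) ^+ 2) `^ (p / 2).
Proof.
move=> p0 b01; rewrite ger0_norm ?powR_ge0//.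
rewrite ge0_ler_powR ?divr_ge0// ?nnegrE ?sqr_ge0//.
  by rewrite ltW// sqnorm_gt0.
have /andP[b0 _] := b01.
have : 0 <= b * (1 - cos (2 * pi * t)) by rewrite mulr_ge0// subr_ge0 cos_le1.
by rewrite /sqnorm; nra.
Qed.

Lemma is_derive_cos_scale (c x : R) :
  is_derive x (1 : R) (fun y => cos (c * y)) (- (c * sin (c * x))).
Proof.
have H : is_derive x (1 : R) (fun y : R => c * y) c.
  have := is_deriveZ c (is_derive_id x (1 : R)).
  by rewrite /GRing.scale/= mulr1.
have := is_derive1_comp (is_derive_cos (c * x)) H.
by rewrite mulNr mulrC.
Qed.

Lemma is_derive_sin_scale (c x : R) :
  is_derive x (1 : R) (fun y => sin (c * y)) (c * cos (c * x)).
Proof.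
have H : is_derive x (1 : R) (fun y : R => c * y) c.
  have := is_deriveZ c (is_derive_id x (1 : R)).
  by rewrite /GRing.scale/= mulr1.
have := is_derive1_comp (is_derive_sin (c * x)) H.
by rewrite mulrC.
Qed.

Lemma continuous_cos_scale (c : R) : continuous (fun x : R => cos (c * x)).
Proof. exact/continuous_scale/continuous_cos. Qed.

Lemma continuous_sin_scale (c : R) : continuous (fun x : R => sin (c * x)).
Proof. exact/continuous_scale/continuous_sin. Qed.

Lemma is_derive_sqnorm b x :
  is_derive x (1 : R) (sqnorm b) (- (4 * pi * b * sin (2 * pi * x))).
Proof.
have H := is_deriveZ (2 * b) (is_derive_cos_scale (2 * pi) x).
have H' : is_derive x (1 : R) (sqnorm b) _ :=
  is_deriveD (is_deriveD (is_derive_cst (1 : R) x (1 : R)) H)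
  (is_derive_cst (b ^+ 2 : R) x (1 : R)).
apply: is_derive_eq.
by rewrite /GRing.scale/=; ring.
Qed.

Lemma is_derive_sqnorm_powR b r x : 0 <= b < 1 ->
  is_derive x (1 : R) (fun y => sqnorm b y `^ r)
    (r * sqnorm b x `^ (r - 1) * - (4 * pi * b * sin (2 * pi * x))).
Proof.
move=> b01.
exact: (is_derive1_comp (is_derive1_powR r (sqnorm_gt0 x b01)) (is_derive_sqnorm b x)).
Qed.

Lemma continuous_sqnorm_powR b r : 0 <= b < 1 ->
  continuous (fun y => sqnorm b y `^ r).
Proof.
move=> b01 x; apply/differentiable_continuous/derivable1_diffP.
by have [] := is_derive_sqnorm_powR r x b01.
Qed.

Lemma continuous_powfactor b : 0 <= b < 1 -> continuous (powfactor b).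
Proof. exact: continuous_sqnorm_powR. Qed.

(** The kernel is even, so this is its exponential Fourier coefficient, without the factor 2 of
    cosine series. *)
Definition fourier b n : R := mean (fun y => powfactor b y * cos (2 * pi * n%:R * y)).

Lemma continuous_powfactor_cos b (c : R) : 0 <= b < 1 ->
  continuous (fun y => powfactor b y * cos (c * y)).
Proof.
move=> b01 x; apply: cvgM; first exact: continuous_powfactor.
exact: continuous_cos_scale.
Qed.

Lemma fourier0E b : fourier b 0 = mean (powfactor b).
Proof. by apply: eq_mean => x _; rewrite mulr0 mul0r cos0 mulr1. Qed.

Lemma fourier0_gt0 b : 0 <= p -> 0 <= b < 1 -> 0 < fourier b 0.
Proof.
move=> p0 b01; have /andP[b0 b1] := b01.
pose m := ((1 - b) ^+ 2) `^ (p / 2).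
have m0 : 0 < m by rewrite powR_gt0// exprn_gt0// subr_gt0.
rewrite fourier0E (lt_le_trans m0)// -(mean_cst m).
apply: ler_mean; first exact: bounded_measurable_cst.
  exact/continuous_bounded_measurable/continuous_powfactor.
move=> x _; rewrite /m ge0_ler_powR ?divr_ge0// ?nnegrE.
- by rewrite sqr_ge0.
- by rewrite ltW// sqnorm_gt0.
have : 0 <= b * (1 + cos (2 * pi * x)).
  by rewrite mulr_ge0// -lerBlDl sub0r cos_geN1.
by rewrite /sqnorm; nra.
Qed.

Lemma mean_powfactor_sin b n : 0 <= b < 1 ->
  mean (fun y => powfactor b y * sin (2 * pi * n%:R * y)) = 0.
Proof.
move=> b01; apply: mean_odd.
  by move=> x; apply: cvgM; [exact: continuous_powfactor|exact: continuous_sin_scale].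
move=> x; have -> : powfactor b (1 - x) = powfactor b x.
  by rewrite addrC (powfactor_periodic b 1 (- x)) powfactorN.
have -> : 2 * pi * n%:R * (1 - x) = 2 * pi * (- (n%:R * x) + n%:R) by ring.
by rewrite sin2pi_periodic !mulrN sinN mulrA mulrN.
Qed.

(* Integrate the derivative of [sqnorm b y `^ (p / 2 + 1) * sin (2 pi n y)]. *)
Lemma fourier_rec b n : 0 <= b < 1 ->
  b * (n%:R - p / 2) * fourier b n + n.+1%:R * (1 + b ^+ 2) * fourier b n.+1
  + b * (n%:R + 2 + p / 2) * fourier b n.+2 = 0.
Proof.
move=> b01.
pose c : R := 2 * pi * n.+1%:R.
pose S : R -> R := fun y => sin (c * y).
pose F y := sqnorm b y `^ (p / 2 + 1) * S y.
pose f (k : nat) y := powfactor b y * cos (2 * pi * k%:R * y).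
have cf k : continuous (f k) by exact: continuous_powfactor_cos.
pose G y := b * (n%:R - p / 2) * f n y + n.+1%:R * (1 + b ^+ 2) * f n.+1 y
  + b * (n%:R + 2 + p / 2) * f n.+2 y.
have dF (x : R) : is_derive x (1 : R) F (2 * pi * G x).
  have H : is_derive x (1 : R) F _ :=
    is_deriveM (is_derive_sqnorm_powR (p / 2 + 1) x b01) (is_derive_sin_scale c x).
  apply: is_derive_eq; rewrite /GRing.scale/= addrK.
  have -> : sqnorm b x `^ (p / 2 + 1) = sqnorm b x * powfactor b x.
    have D0 := sqnorm_gt0 x b01.
    by rewrite powRD ?(gt_eqF D0) ?implybT// powRr1 1?mulrC// ltW.
  rewrite /G /f -/(powfactor b x).
  (* Around the central frequency [n.+1], the addition formulas reduce the claim to a polynomial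
     identity. *)
  have -> : 2 * pi * n%:R * x = c * x - 2 * pi * x by rewrite /c -natr1; ring.
  have -> : 2 * pi * n.+2%:R * x = c * x + 2 * pi * x by rewrite /c -[n.+2%:R]natr1; ring.
  rewrite -/c cosB cosD /sqnorm -natr1 /c -natr1.
  move: (sin _) (cos _) (sin _) (cos _) (powfactor _ _) => s1 c1 s2 c2 k; ring.
have cG : continuous G.
  move=> x; apply: cvgD; [apply: cvgD|]; apply: cvgM;
    [exact: cvg_cst|exact: cf|exact: cvg_cst|exact: cf|exact: cvg_cst|exact: cf].
have c2G : continuous (fun x => 2 * pi * G x).
  by move=> x; apply: cvgM; [exact: cvg_cst|exact: cG].
have bf k : bounded_measurable (f k) by exact: continuous_bounded_measurable.
have := mean_derive dF c2G.
rewrite meanZ; last exact: continuous_bounded_measurable.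
have -> : F 1 = 0.
  by rewrite /F /S /c -mulrA mulr1 -[n.+1%:R]add0r sin2pi_periodic mulr0 sin0 mulr0.
have -> : F 0 = 0 by rewrite /F /S mulr0 sin0 mulr0.
rewrite subrr => /eqP; rewrite !mulf_eq0 pnatr_eq0/= gt_eqF ?pi_gt0//= => /eqP.
rewrite /G meanD; [|exact/bounded_measurableD/bounded_measurableZ/bf/bounded_measurableZ/bf|
   exact/bounded_measurableZ/bf].
rewrite meanD; try exact/bounded_measurableZ/bf.
by rewrite !meanZ.
Qed.

End powfactor.

(* If the tail of [d] were nonnegative, the recurrence would make it vanish, and
   [A n != 0] would propagate the zeros down to [d 0]. *)
Lemma recurrence_neg {R : realType} (A B C d : nat -> R) (n0 : nat) :
  (forall n, A n != 0) -> (forall n, (n0 <= n)%N -> 0 < A n) ->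
  (forall n, 0 < B n) -> (forall n, 0 < C n) ->
  (forall n, A n * d n + B n * d n.+1 + C n * d n.+2 = 0) ->
  d 0%N != 0 -> forall N, exists2 n, (N <= n)%N & d n < 0.
Proof.
move=> A0 Agt Bgt Cgt rec d0 N; apply: contrapT => nneg.
have dge0 n : (N <= n)%N -> 0 <= d n.
  by move=> Nn; rewrite leNgt; apply/negP => dn; apply: nneg; exists n.
have zero n : (maxn N n0 <= n)%N -> d n = 0.
  rewrite geq_max => /andP[Nn n0n].
  have d_ge0 := dge0 _ Nn.
  have d1_ge0 := dge0 _ (leqW Nn).
  have d2_ge0 := dge0 _ (leqW (leqW Nn)).
  have /eqP : A n * d n = 0.
    have := rec n.
    have : 0 <= A n * d n by rewrite mulr_ge0// ltW// Agt.
    have : 0 <= B n * d n.+1 by rewrite mulr_ge0// ltW.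
    have : 0 <= C n * d n.+2 by rewrite mulr_ge0// ltW.
    lra.
  by rewrite mulf_eq0 (negbTE (A0 n))/= => /eqP.
(* Two consecutive zeros travel downwards. Once [k] reaches the starting index, truncated
   subtraction keeps the position at 0 and nothing is left to prove. *)
have down k : d (maxn N n0 - k)%N = 0 /\ d (maxn N n0 - k).+1 = 0.
  elim: k => [|k [IH1 IH2]]; first by rewrite subn0; split; apply: zero.
  have [Mk|Mk] := leqP (maxn N n0) k.
    have e : (maxn N n0 - k.+1 = maxn N n0 - k)%N by lia.
    by rewrite e.
  have e : (maxn N n0 - k = (maxn N n0 - k.+1).+1)%N by lia.
  split; last by rewrite -e.
  have := rec (maxn N n0 - k.+1)%N; rewrite -e IH1 IH2 !mulr0 !addr0 => /eqP.
  by rewrite mulf_eq0 (negbTE (A0 _))/= => /eqP.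
have [+ _] := down (maxn N n0); rewrite subnn => d00.
by rewrite d00 eqxx in d0.
Qed.

(** A negative term of [- s * fourier p b n] is a coefficient with the sign of [s]. The bound
    [2 <= K] serves the gaps in [admissibleM]. *)
Lemma fourier_sign {R : realType} (p b s : R) : 0 < p ->
  (forall k : nat, p <> (2 * k)%:R) -> 0 < b < 1 -> s != 0 ->
  exists2 K, (2 <= K)%N & 0 < s * fourier p b K.
Proof.
move=> p0 pne /andP[b0 b1] s0.
have b01 : 0 <= b < 1 by rewrite ltW.
pose A n := b * (n%:R - p / 2).
pose B n := n.+1%:R * (1 + b ^+ 2).
pose C n := b * (n%:R + 2 + p / 2).
(* [A n] is positive as soon as [n > p / 2], so any start beyond [p] is safe; it vanishes only for
   [p = 2 n], which is excluded. *)
have [] // := @recurrence_neg R A B C (fun n => - s * fourier p b n)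
    (Num.truncn p).+1 _ _ _ _ _ _ 2.
- move=> n; rewrite mulf_neq0 ?(gt_eqF b0)// subr_eq0; apply/eqP => np.
  by apply: (pne n); rewrite natrM np; lra.
- move=> n pn; rewrite mulr_gt0// subr_gt0.
  have := truncnS_gt p; rewrite -(ler_nat R) in pn => /lt_le_trans/(_ pn).
  by lra.
- by move=> n; rewrite mulr_gt0// ltr_wpDr// sqr_ge0.
- by move=> n; rewrite mulr_gt0// addr_gt0// ?divr_gt0// ltr_wpDl.
- move=> n; transitivity (- s * (A n * fourier p b n +
    B n * fourier p b n.+1 + C n * fourier p b n.+2)); first by ring.
  by rewrite fourier_rec// mulr0.
- by rewrite mulf_neq0 ?oppr_eq0// gt_eqF// fourier0_gt0// ltW.
by move=> n n2; rewrite mulNr oppr_lt0; exists n.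
Qed.

(** * Fejer's lemma *)

Section fejer.
Context {R : realType}.
Local Notation mu := (@lebesgue_measure R).
Implicit Types (W F : R -> R) (m j n : nat).

Let cell m j : set R := `[j%:R / m.+1%:R, j.+1%:R / m.+1%:R].

(** The substitution [F] maps the cell onto the unit interval, and the integer shift disappears by
    periodicity. *)
Lemma cell_mean W m j : continuous W ->
  (forall n y, W (y + n%:R) = W y) ->
  \int[mu]_(x in cell m j) W (m.+1%:R * x) = mean W / m.+1%:R.
Proof.
move=> cW pW.
pose F (x : R) := m.+1%:R * x - j%:R.
have m0 : 0 < m.+1%:R :> R by [].
have dF (x : R) : is_derive x (1 : R) F m.+1%:R.
  have H : is_derive x (1 : R) F _ :=
    is_deriveB (is_deriveZ (m.+1%:R : R) (is_derive_id x (1 : R)))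
      (is_derive_cst (j%:R : R) x (1 : R)).
  by apply: is_derive_eq; rewrite /GRing.scale/= mulr1 subr0.
have F' : F^`()%classic = cst m.+1%:R.
  by apply/funext => x; rewrite derive1E; have [_ ->] := dF x.
have cF : continuous F.
  by move=> x; apply/differentiable_continuous/derivable1_diffP; have [] := dF x.
have Fa : F (j%:R / m.+1%:R) = 0 by rewrite /F; field; exact: lt0r_neq0.
have Fb : F (j.+1%:R / m.+1%:R) = 1.
  by rewrite /F -[j.+1]addn1 natrD; field; exact: lt0r_neq0.
have WF x : W (F x) = W (m.+1%:R * x) by rewrite -(pW j) /F subrK.
have bF : mu.-integrable (cell m j) (EFin \o (fun x => W (m.+1%:R * x))).
  apply: continuous_compact_integrable; first exact: segment_compact.
  by apply: continuous_subspaceT; exact: continuous_scale.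
(* Multiplying and dividing by [m.+1] brings the Jacobian of [F] under the integral. *)
rewrite -[LHS](mulfK (lt0r_neq0 m0)); congr (_ / _).
rewrite -RintegralZr//; last exact: measurable_itv.
have := @integration_by_substitution_increasing R F W (j%:R / m.+1%:R) (j.+1%:R / m.+1%:R).
rewrite Fa Fb F' /mean /Rintegral => ->.
- by congr fine; apply: eq_integral => x _; rewrite !fctE /= WF.
- by rewrite ler_pM2r ?invr_gt0// ler_nat.
- by move=> x y _ _ xy; rewrite /F ltrD2r ltr_pM2l.
- by move=> ? _; exact: cvg_cst.
- exact: is_cvg_cst.
- exact: is_cvg_cst.
- split=> [x _||]; [by have [] := dF x|exact: cvg_at_right_filter (cF _)|
    exact: cvg_at_left_filter (cF _)].
- exact: continuous_subspaceT.
Qed.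

Lemma cell_subset m j : (j < m.+1)%N -> cell m j `<=` `[0, 1].
Proof.
move=> jm x; rewrite /cell /= !in_itv/= => /andP[jx xj].
rewrite (le_trans _ jx)//= (le_trans xj)// ler_pdivrMr// mul1r ler_nat.
exact: jm.
Qed.

Lemma le_norm_cell F m j (c : R) : (j < m.+1)%N -> bounded_measurable F ->
  (forall x, x \in cell m j -> `|F x| <= c) ->
  `|\int[mu]_(x in cell m j) F x| <= c / m.+1%:R.
Proof.
move=> jm bF Fc.
have iF G : bounded_measurable G -> mu.-integrable (cell m j) (EFin \o G).
  move=> /bounded_measurable_integrable; apply: integrableS;
    [exact: measurable_itv|exact: measurable_itv|exact: cell_subset].
have mc : measurable (cell m j) by exact: measurable_itv.
rewrite (le_trans (le_normr_Rintegral _ (iF _ bF)))//.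
have -> : c / m.+1%:R = \int[mu]_(x in cell m j) c.
  rewrite Rintegral_cst//= lebesgue_measure_itv/= lte_fin.
  rewrite ltr_pM2r ?invr_gt0// ltr_nat ltnS leqnn/=; congr (c * _).
  by rewrite -mulrBl -[j.+1%:R]natr1 addrAC subrr add0r mul1r.
apply: le_Rintegral => [//|||x /= xm].
- exact/iF/bounded_measurable_norm.
- exact/iF/bounded_measurable_cst.
- by apply: Fc; rewrite inE.
Qed.

(** The cells tile the unit interval; [H] adds them one at a time from the left. *)
Lemma le_norm_mean_cells F m (c : R) : bounded_measurable F ->
  (forall j, (j < m.+1)%N -> `|\int[mu]_(x in cell m j) F x| <= c / m.+1%:R) ->
  `|mean F| <= c.
Proof.
move=> bF Fc.
have m0 : 0 < m.+1%:R :> R by [].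
have iF := bounded_measurable_integrable bF.
have H j : (j <= m.+1)%N ->
    `|\int[mu]_(x in `[0, j%:R / m.+1%:R]) F x| <= c * j%:R / m.+1%:R.
  elim: j => [_|j IHj jm].
    by rewrite mulr0 !mul0r set_itv1 Rintegral_set1 normr0.
  have jj : j%:R / m.+1%:R <= j.+1%:R / m.+1%:R :> R.
    by rewrite ler_pM2r ?invr_gt0// ler_nat.
  have j0 : 0 <= j%:R / m.+1%:R :> R by rewrite divr_ge0.
  have j1 : j.+1%:R / m.+1%:R <= 1 :> R by rewrite ler_pdivrMr// mul1r ler_nat.
  have iF' : mu.-integrable `[0, j.+1%:R / m.+1%:R] (EFin \o F).
    by apply: integrableS iF => //; apply: subset_itvl; rewrite bnd_simp.
  have iFc : mu.-integrable `]j%:R / m.+1%:R, j.+1%:R / m.+1%:R] (EFin \o F).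
    by apply: integrableS iF' => //; apply: subset_itvr; rewrite bnd_simp.
  have /eqP := @Rintegral_itvB R F (BLeft 0) (BRight (j.+1%:R / m.+1%:R))
    (j%:R / m.+1%:R) iF' j0 jj.
  rewrite subr_eq Rintegral_itv_obnd_cbnd// => /eqP ->.
  have -> : c * j.+1%:R / m.+1%:R = c / m.+1%:R + c * j%:R / m.+1%:R.
    by rewrite -[j.+1%:R]natr1; ring.
  rewrite (le_trans (ler_normD _ _))//.
  by rewrite lerD// ?IHj ?Fc// ltnW.
by have := H m.+1 (leqnn _); rewrite divff ?mulfK// gt_eqF.
Qed.

Section oscillation.
Variables (Psi : R -> R -> R).
Hypothesis Psi_periodic : forall x n y, Psi x (y + n%:R) = Psi x y.
Hypothesis Psi_continuous : forall x, continuous (Psi x).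
Hypothesis Psi_uniform : forall e : R, 0 < e -> exists2 d : R, 0 < d &
  forall x x' y, 0 <= x <= 1 -> 0 <= x' <= 1 -> 0 <= y <= 1 ->
    `|x - x'| < d -> `|Psi x y - Psi x' y| <= e.
Hypothesis Psi_diag : forall m, bounded_measurable (fun x => Psi x (m%:R * x)).
Hypothesis Psi_mean : bounded_measurable (fun x => mean (Psi x)).

Lemma fejer : mean (fun x => Psi x (m%:R * x)) @[m --> \oo] -->
  mean (fun x => mean (Psi x)).
Proof.
apply/cvgrPdist_le => e e0.
have e20 : 0 < e / 2 by rewrite divr_gt0.
have [d d0 Pd] := Psi_uniform e20.
suff core m : m.+1%:R^-1 < d ->
    `|mean (fun x => mean (Psi x)) - mean (fun x => Psi x (m.+1%:R * x))| <= e.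
  near=> m.
  have m0 : (0 < m)%N by near: m; exists 1%N.
  rewrite -(prednK m0); apply: core; rewrite (prednK m0).
  have dm : d^-1 < m%:R by near: m; exact: nbhs_infty_gtr.
  rewrite -[d]invrK ltf_pV2 ?posrE ?invr_gt0//.
  by rewrite (lt_trans _ dm)// invr_gt0.
move=> md.
have m0 : 0 < m.+1%:R :> R by [].
rewrite distrC -meanB//.
apply: (@le_norm_mean_cells _ m) => [|j jm]; first exact: bounded_measurableB.
pose x0 : R := j%:R / m.+1%:R.
pose k x := Psi x0 (m.+1%:R * x) - mean (Psi x0).
have x001 : 0 <= x0 <= 1.
  by rewrite /x0 divr_ge0//= ler_pdivrMr// mul1r ler_nat ltnW.
have bP : bounded_measurable (fun x => Psi x0 (m.+1%:R * x)).
  exact/continuous_bounded_measurable/continuous_scale/Psi_continuous.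
have bk : bounded_measurable k by apply: bounded_measurableB => //; exact: bounded_measurable_cst.
have iF G : bounded_measurable G -> mu.-integrable (cell m j) (EFin \o G).
  move=> /bounded_measurable_integrable; apply: integrableS;
    [exact: measurable_itv|exact: measurable_itv|exact: cell_subset].
have mc : measurable (cell m j) by exact: measurable_itv.
have k0 : \int[mu]_(x in cell m j) k x = 0.
  rewrite RintegralB//; [|exact: iF|exact/iF/bounded_measurable_cst].
  rewrite (@cell_mean _ m j (@Psi_continuous x0) (@Psi_periodic x0)).
  rewrite Rintegral_cst//= lebesgue_measure_itv/= lte_fin.
  rewrite ltr_pM2r ?invr_gt0// ltr_nat ltnS leqnn/=.
  by rewrite -mulrBl -[j.+1%:R]natr1 addrAC subrr add0r mul1r subrr.
(* Subtracting [k], whose integral over the cell is 0, leaves two freezing errors of at most [e / 2]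
   each. *)
rewrite -[X in `|X|]subr0 -k0 -RintegralB//; try by apply: iF => //; exact: bounded_measurableB.
apply: le_norm_cell => //; first by apply: bounded_measurableB => //; exact: bounded_measurableB.
move=> x; rewrite inE /cell/= in_itv/= => /andP[jx xj].
have x01 : 0 <= x <= 1.
  rewrite (le_trans _ jx) ?divr_ge0//= (le_trans xj)// ler_pdivrMr// mul1r ler_nat.
  exact: jm.
have xx0 : `|x - x0| < d.
  rewrite ger0_norm ?subr_ge0// (le_lt_trans _ md)// lerBlDl (le_trans xj)//.
  by rewrite -natr1 mulrDl mul1r.
rewrite /k (_ : _ - _ = (Psi x (m.+1%:R * x) - Psi x0 (m.+1%:R * x)) -
  (mean (Psi x) - mean (Psi x0))); last by ring.
rewrite [e]splitr (le_trans (ler_normB _ _))// lerD//.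
  (* The fast variable is shifted by [j] into the unit interval, where [Psi_uniform] applies. *)
  rewrite -(subrK j%:R (m.+1%:R * x)) !Psi_periodic; apply: Pd => //.
  rewrite subr_ge0 mulrC -ler_pdivrMr// jx/= lerBlDl mulrC natr1.
  by rewrite mulrC -ler_pdivlMr.
rewrite -meanB; try exact: continuous_bounded_measurable.
apply: ler_norm_mean_le => [|y y01]; last exact: Pd.
by apply: bounded_measurableB; exact: continuous_bounded_measurable.
Unshelve. all: by end_near. Qed.

End oscillation.

End fejer.

Section fejer_weight.
Context {R : realType}.
Local Notation mu := (@lebesgue_measure R).

Lemma continuous_mean_approx (h : R -> R) (e : R) : bounded_measurable h -> 0 < e ->
  exists2 g : R -> R, continuous g & mean (fun x => `|h x - g x|) <= e.
Proof.
move=> bh e0.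
have mI : (mu `[0%R, 1%R] < +oo)%E.
  by rewrite /= lebesgue_measure_itv/= lte_fin ltr01 oppr0 addr0 ltry.
have [g [cg ig]] := approximation_continuous_integrable (measurable_itv _) mI
  (bounded_measurable_integrable bh).
move=> /fine_cvgP[_ /cvgrPdist_le/(_ e e0)[n _ /(_ n (leqnn n))/=]].
rewrite sub0r normrN => gne; exists (g n) => //.
by rewrite (le_trans _ gne)// ler_norm.
Qed.

(** As [h] is only measurable, [fejer] is applied with a continuous [g] close to [h] in mean. The
    bound [C] on [Phi] makes the cost of this replacement uniform in [m]. *)
Lemma fejer_weight (h : R -> R) (Phi : R -> R -> R) (C : R) :
  bounded_measurable h ->
  (forall x n y, Phi x (y + n%:R) = Phi x y) ->
  (forall x, continuous (Phi x)) ->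
  (forall e : R, 0 < e -> exists2 d : R, 0 < d &
    forall x x' y, 0 <= x <= 1 -> 0 <= x' <= 1 -> 0 <= y <= 1 ->
    `|x - x'| < d -> `|Phi x y - Phi x' y| <= e) ->
  (forall x y, `|Phi x y| <= C) ->
  (forall m, bounded_measurable (fun x => Phi x (m%:R * x))) ->
  bounded_measurable (fun x => mean (Phi x)) ->
  mean (fun x => h x * Phi x (m%:R * x)) @[m --> \oo] -->
  mean (fun x => h x * mean (Phi x)).
Proof.
move=> bh Phip Phic Phiu PhiC Phid Phim.
have C0 : 0 <= C by rewrite (le_trans _ (PhiC 0 0)).
have PhimC x : `|mean (Phi x)| <= C.
  by apply: ler_norm_mean_le => [|y _ //]; exact: continuous_bounded_measurable.
apply/cvgrPdist_le => e e0.
(* Two replacements of [h] by [g] and one limit cost [e / 3] each; [C + 1] avoids a division by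
   0. *)
pose e1 := e / 3 / (C + 1).
have C1 : 0 < C + 1 by rewrite ltr_wpDl.
have e10 : 0 < e1 by rewrite !divr_gt0.
have [g cg ge] := continuous_mean_approx bh e10.
have bg := continuous_bounded_measurable cg.
have [G gG] := bg.2.
have G0 : 0 <= G by rewrite (le_trans _ (gG 0 _))// lexx ler01.
have gPhi x : mean (fun y => g x * Phi x y) = g x * mean (Phi x).
  by rewrite meanZ//; exact: continuous_bounded_measurable.
have : mean (fun x => g x * Phi x (m%:R * x)) @[m --> \oo] -->
    mean (fun x => mean (fun y => g x * Phi x y)).
  apply: (@fejer R (fun x y => g x * Phi x y)).
  - by move=> x n y; rewrite Phip.
  - by move=> x y; apply: cvgM; [exact: cvg_cst|exact: Phic].
  - move=> r r0.
    have rG : 0 < r / 2 / (G + 1) by rewrite !divr_gt0// ltr_wpDl.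
    have rC : 0 < r / 2 / (C + 1) by rewrite !divr_gt0.
    have [d1 d10 Hd1] := Phiu _ rG.
    have [d2 d20 Hd2] := uniformly_continuous_segment 0 1 cg rC.
    exists (Num.min d1 d2); first by rewrite lt_min d10.
    move=> x x' y x01 x'01 y01; rewrite lt_min => /andP[xx1 xx2].
    have -> : g x * Phi x y - g x' * Phi x' y =
      g x * (Phi x y - Phi x' y) + (g x - g x') * Phi x' y by ring.
    rewrite (le_trans (ler_normD _ _))// [r]splitr lerD// normrM.
      rewrite (@le_trans _ _ ((G + 1) * (r / 2 / (G + 1))))//.
        by rewrite ler_pM// ?Hd1// (le_trans (gG _ x01))// lerDl.
      by rewrite mulrC divfK// gt_eqF// ltr_wpDl.
    rewrite (@le_trans _ _ ((r / 2 / (C + 1)) * (C + 1)))//.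
      by rewrite ler_pM// ?ltW ?Hd2// (le_lt_trans (PhiC _ _))// ltrDl.
    by rewrite divfK// gt_eqF.
  - by move=> m; exact: bounded_measurableM.
  - rewrite (_ : (fun x => _) = fun x => g x * mean (Phi x)); last exact/funext.
    exact: bounded_measurableM.
under eq_mean do rewrite gPhi.
have e30 : 0 < e / 3 by rewrite divr_gt0.
move=> /cvgrPdist_le/(_ _ e30); apply: filterS => m gm.
have hg : bounded_measurable (fun x => h x - g x) by exact: bounded_measurableB.
have ahg : bounded_measurable (fun x => `|h x - g x|) by exact: bounded_measurable_norm.
have small F : bounded_measurable F -> (forall x, `|F x| <= C) ->
    `|mean (fun x => (h x - g x) * F x)| <= e / 3.
  move=> bF FC; rewrite (le_trans (ler_norm_mean _))//; first exact: bounded_measurableM.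
  rewrite (@le_trans _ _ ((C + 1) * mean (fun x => `|h x - g x|)))//.
    rewrite -meanZ//; apply: ler_mean.
    - exact/bounded_measurable_norm/bounded_measurableM.
    - exact: bounded_measurableZ.
    - move=> x _; rewrite normrM mulrC ler_wpM2r// (le_trans (FC x))// lerDl//.
  by rewrite -ler_pdivlMl// mulrC.
have s1 := small _ Phim PhimC.
have s2 := small _ (Phid m) (fun x => PhiC _ _).
have b1 : mean (fun x => (h x - g x) * mean (Phi x)) =
    mean (fun x => h x * mean (Phi x)) - mean (fun x => g x * mean (Phi x)).
  rewrite -meanB; [by apply: eq_mean => x _; ring|exact: bounded_measurableM|
    exact: bounded_measurableM].
have b2 : mean (fun x => (h x - g x) * Phi x (m%:R * x)) =
    mean (fun x => h x * Phi x (m%:R * x)) - mean (fun x => g x * Phi x (m%:R * x)).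
  rewrite -meanB; [by apply: eq_mean => x _; ring|exact: bounded_measurableM|
    exact: bounded_measurableM].
rewrite b1 in s1; rewrite b2 in s2.
move: s1 s2 gm; rewrite !ler_norml; lra.
Qed.

End fejer_weight.

(** * Polynomials with gaps and weights *)

Section gapped.
Context {R : realType}.
Implicit Types (N c x : R) (f : R -> R[i]) (d h k : nat).

(** The degree bound [d] tells how far the next frequency must lie. Gaps are asked of all pairs,
    which spares tracking neighbours when frequency sets are joined. *)
Definition gapped N d f : Prop := exists (H : {fset nat}) (a : nat -> R),
  [/\ posdef_expansion H a f,
      forall h, h \in H -> (h <= d)%N
    & forall h k, h \in H -> k \in H -> (h < k)%N -> N < k%:R - h%:R].

Lemma gapped_Pplus N d f : gapped N d f -> Pplus f.
Proof. by move=> [H [a [+ _ _]]]; exists H, a. Qed.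

Lemma gapped_gaps N d f : gapped N d f -> gaps_larger_than N f.
Proof.
by move=> [H [a [? _ HN]]]; exists H, a; split => // h k [hH kH hk _]; exact: HN.
Qed.

Lemma expi2piD (s t : R) : expi2pi (s + t) = expi2pi s * expi2pi t.
Proof.
rewrite /expi2pi mulrDr cosD sinD; apply/eqP; rewrite eq_complex /=.
by apply/andP; split => //; rewrite addrC (mulrC (cos _)) (mulrC (sin _)).
Qed.

Definition dilated_factor c k x : R[i] := 1 + real_complex R c * expi2pi (k%:R * x).

Lemma gapped1 N : gapped N 0 (fun=> 1).
Proof.
exists [fset 0%N]%fset, (fun=> 1); split.
- split.
  + by apply/fset0Pn; exists 0%N; rewrite inE.
  + by [].
  + move=> x; rewrite /trigpoly big_seq_fset1 mul0r /expi2pi mulr0 cos0 sin0.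
    by rewrite mulr1.
- by move=> h; rewrite inE => /eqP ->.
- by move=> h k; rewrite !inE => /eqP -> /eqP ->; rewrite ltnn.
Qed.

(** The new frequencies are [H] and its translate by [k]. As [H] lies in [[0, d]], the translate is
    disjoint from it and at distance at least [k - d > N]. *)
Lemma gappedM N d f c k : gapped N d f -> N + d%:R < k%:R -> (d < k)%N -> 0 < c ->
  gapped N (d + k) (fun x => f x * dilated_factor c k x).
Proof.
move=> [H [a [[H0 a0 fE] Hd HN]]] Ndk dk c0.
pose s := (H : seq nat) ++ [seq (h + k)%N | h <- H].
(* Comparison with [k] separates [H] from its translate, since [H] stays below [k]. *)
pose b h := if (h < k)%N then a h else c * a (h - k)%N.
have us : uniq s.
  rewrite cat_uniq fset_uniq/= map_inj_uniq ?fset_uniq ?andbT//; last exact: addIn.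
  apply/hasPn => _ /mapP[h hH ->]; apply/negP => /= /Hd; lia.
have sE h : h \in seq_fset tt s -> (h \in H /\ b h = a h /\ (h <= d)%N) \/
    (exists h', [/\ h' \in H, h = (h' + k)%N, (h' <= d)%N & b h = c * a h']).
  rewrite seq_fsetE mem_cat => /orP[hH|/mapP[h' hH ->]].
    by left; split => //; rewrite /b (leq_ltn_trans (Hd _ hH) dk) Hd.
  right; exists h'; split => //; first exact: Hd.
  by rewrite /b ltnNge leq_addl/= addnK.
exists (seq_fset tt s), b; split.
- split.
  + have /fset0Pn[h hH] := H0.
    by apply/fset0Pn; exists h; rewrite seq_fsetE mem_cat hH.
  + move=> h /sE[[hH [-> _]]|[h' [h'H _ _ ->]]]; first exact: a0.
    by rewrite mulr_gt0// a0.
  + move=> x; rewrite fE /trigpoly (perm_big _ (seq_fset_perm tt s)) undup_id//=.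
    rewrite big_cat big_map /dilated_factor mulrDr mulr1 mulr_suml; congr (_ + _).
      apply: eq_big_seq => h hH; rewrite /b.
      by rewrite (leq_ltn_trans (Hd _ hH) dk).
    apply: eq_big_seq => h hH; rewrite /b ltnNge leq_addl/= addnK.
    rewrite natrD mulrDl expi2piD rmorphM/=.
    move: (real_complex _ _) (expi2pi _) (real_complex _ _) (expi2pi _) => u v w z.
    by rewrite mulrACA (mulrC u w) -!mulrA.
- by move=> h /sE[[_ [_ +]]|[h' [_ -> + _]]]; lia.
- move=> h l /sE[[hH [_ hd]]|[h' [hH -> hd _]]] /sE[[lH [_ ld]]|[l' [lH -> ld _]]].
  + exact: HN.
  + move=> _; rewrite natrD; move: hd; rewrite -(ler_nat R).
    have : 0 <= l'%:R :> R by [].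
    lra.
  + lia.
  + rewrite ltn_add2r !natrD => /(HN _ _ hH lH); lra.
Qed.

Lemma normc_dilated_factor (p : R) c k x :
  Normc.normc (dilated_factor c k x) `^ p = powfactor p c (k%:R * x).
Proof.
have -> : Normc.normc (dilated_factor c k x) = Num.sqrt (sqnorm c (k%:R * x)).
  rewrite /= !mul0r subr0 addr0 add0r; congr Num.sqrt.
  by rewrite /sqnorm [(_ * sin _) ^+ 2]exprMn sin2cos2; ring.
(* Here [c] is arbitrary, so nonnegativity comes from a sum of two squares. *)
have s0 : 0 <= sqnorm c (k%:R * x).
  rewrite (_ : sqnorm _ _ = (1 + c * cos (2 * pi * (k%:R * x))) ^+ 2 +
   (c * sin (2 * pi * (k%:R * x))) ^+ 2) ?addr_ge0 ?sqr_ge0//.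
  by rewrite /sqnorm [(_ * sin _) ^+ 2]exprMn sin2cos2; ring.
by rewrite -powR12_sqrt// -powRrM (mulrC _ p).
Qed.

End gapped.

Section weights.
Context {R : realType}.
Variables (N p : R).
Hypothesis p_gt0 : 0 < p.
Implicit Types (f : R -> R[i]) (h w : R -> R).

Lemma normc_ge0 (z : R[i]) : 0 <= Normc.normc z.
Proof. by case: z => u v; exact: sqrtr_ge0. Qed.

Definition pnorm f x : R := Normc.normc (f x) `^ p.

(** Boundedness of [pnorm f] is carried along so that the products under [mean] stay integrable. *)
Definition admissible f : Prop :=
  (exists d, gapped N d f) /\ bounded_measurable (pnorm f).

Definition weight w : Prop := bounded_measurable w /\
  forall h f, bounded_measurable h -> admissible f ->
    0 < mean (fun x => h x * pnorm f x * w x) ->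
    exists2 g, admissible g & 0 < mean (fun x => h x * pnorm g x).

Lemma weight1 : weight (fun=> 1).
Proof.
split; first exact: bounded_measurable_cst.
move=> h f bh af; under eq_mean do rewrite mulr1.
by exists f.
Qed.

(** Since [h] may be any bounded measurable function, [w1] is absorbed into it while [w2] is
    removed; then [w1] is removed in turn. *)
Lemma weightM w1 w2 : weight w1 -> weight w2 -> weight (fun x => w1 x * w2 x).
Proof.
move=> [bw1 Hw1] [bw2 Hw2]; split; first exact: bounded_measurableM.
move=> h f bh af fw.
have [||g ag hg] := Hw2 (fun x => h x * w1 x) f _ af.
- exact: bounded_measurableM.
- by move: fw; congr (_ < _); apply: eq_mean => x _; ring.
apply: (Hw1 h g) => //.
by move: hg; congr (_ < _); apply: eq_mean => x _; ring.
Qed.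

Lemma weightX w n : weight w -> weight (fun x => w x ^+ n).
Proof.
move=> ww; elim: n => [|n IHn].
  by under eq_fun do rewrite expr0; exact: weight1.
by under eq_fun do rewrite exprS; exact: weightM.
Qed.

Lemma weightZ w (c : R) : 0 < c -> weight w -> weight (fun x => c * w x).
Proof.
move=> c0 [bw Hw]; split; first exact: bounded_measurableZ.
move=> h f bh af fw; apply: (Hw h f) => //.
rewrite -(pmulr_rgt0 _ c0) -meanZ; last first.
  by apply: bounded_measurableM => //; apply: bounded_measurableM => //; exact: af.2.
by move: fw; congr (_ < _); apply: eq_mean => x _; ring.
Qed.

(** By dominated convergence, strict positivity for [w] already holds for some [w_ n]. *)
Lemma weight_cvg (w_ : nat -> R -> R) w (C : R) : (forall n, weight (w_ n)) ->
  (forall n x, 0 <= x <= 1 -> `|w_ n x| <= C) ->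
  (forall x, w_ n x @[n --> \oo] --> w x) -> weight w.
Proof.
move=> ww wC cw.
have mw : measurable_fun [set: R] w.
  apply: (measurable_fun_cvg (h := w_)) => [n|x _]; last exact: cw.
  by have [[]] := ww n.
split.
  split => //; exists C => x x01.
  have nw : `|w_ n x| @[n --> \oo] --> `|w x| by apply: cvg_norm; exact: cw.
  rewrite -(cvg_lim (@Rhausdorff R) nw); apply: limr_le.
    by apply/cvg_ex; exists `|w x|.
  by apply: nearW => n; exact: wC.
move=> h f bh af fw.
have [B HB] : bounded_measurable (fun x => h x * pnorm f x).
  by apply: bounded_measurableM => //; exact: af.2.
have [D HD] := HB.
have D0 : 0 <= D by rewrite (le_trans _ (HD 0 _))// lexx ler01.
have : mean (fun x => h x * pnorm f x * w_ n x) @[n --> \oo] -->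
    mean (fun x => h x * pnorm f x * w x).
  apply: (@mean_cvg _ _ _ (D * C)) => [n||n x x01|x x01].
  - by apply: measurable_funM => //; have [[]] := ww n.
  - exact: measurable_funM.
  - by rewrite normrM ler_pM// ?HD// wC.
  - by apply: cvgM; [exact: cvg_cst|exact: cw].
move=> /cvgr_gt/(_ _ fw)[n _ /(_ n (leqnn n))/= fn].
exact: (ww n).2 fn.
Qed.

Section convolution.
Variables (a b : R).
Hypotheses (a01 : 0 < a < 1) (b01 : 0 < b < 1).
Variables (n K : nat).

Let W := powfactor p a.
Let V := powfactor p b.
(** At [y = m x] the second argument becomes [(n + K m) x]: this is the contribution of the two new
    factors to [pnorm]. Its mean over [y] is [marginal x], the [M_b] of the overview. *)
Let Phi (x y : R) : R := W y * V (n%:R * x + K%:R * y).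

Definition marginal (x : R) : R :=
  mean (fun y => powfactor p a y * powfactor p b (n%:R * x + K%:R * y)).

Let a01' : 0 <= a < 1. Proof. by have /andP[/ltW -> ->] := a01. Qed.
Let b01' : 0 <= b < 1. Proof. by have /andP[/ltW -> ->] := b01. Qed.
Let cW : continuous W. Proof. exact: continuous_powfactor. Qed.
Let cV : continuous V. Proof. exact: continuous_powfactor. Qed.

Let C : R := ((1 + a) ^+ 2) `^ (p / 2) * ((1 + b) ^+ 2) `^ (p / 2).

Let PhiC x y : `|Phi x y| <= C.
Proof. by rewrite /Phi normrM ler_pM// powfactor_le// ltW. Qed.

Let cPhi x : continuous (Phi x).
Proof.
have cl : continuous (fun y : R => n%:R * x + K%:R * y).
  by move=> y; apply: cvgD; [exact: cvg_cst|exact: mulrl_continuous].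
move=> y; apply: cvgM; first exact: cW.
exact: (continuous_comp (cl y) (@cV _)).
Qed.

(** The bound [A] is [|x|] for the continuity of [marginal] and 1 for Fejer's lemma. *)
Let Phi_uniform (A e : R) : 0 < e -> exists2 d : R, 0 < d &
  forall x x' y, `|x| <= A -> 0 <= y <= 1 -> `|x - x'| < d ->
    `|Phi x y - Phi x' y| <= e.
Proof.
move=> e0.
pose c := ((1 + a) ^+ 2) `^ (p / 2) + 1.
have c0 : 0 < c by rewrite ltr_wpDl// powR_ge0.
have ec : 0 < e / c by rewrite divr_gt0.
pose B := n%:R * A + K%:R.
have [d d0 Hd] := uniformly_continuous_segment (- B) B cV ec.
have n1 : 0 < n%:R + 1 :> R by rewrite ltr_wpDl.
(* The denominator is [n + 1] because [n] may be 0. *)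
exists (d / (n%:R + 1)); first by rewrite divr_gt0.
move=> x x' y xA y01 xx'.
rewrite /Phi -mulrBr normrM (@le_trans _ _ (c * (e / c)))//; last first.
  by rewrite mulrC divfK// gt_eqF.
rewrite ler_pM//.
  by rewrite (le_trans (powfactor_le _ _ _))// ?lerDl// ltW.
apply/ltW/Hd.
  rewrite -ler_norml (le_trans (ler_normD _ _))// /B !normrM !normr_nat lerD//.
    by rewrite ler_wpM2l.
  by rewrite ler_piMr// ger0_norm//; case/andP: y01.
rewrite (_ : _ - _ = n%:R * (x - x')); last by ring.
rewrite normrM normr_nat; move: xx'; rewrite ltr_pdivlMr// => /(le_lt_trans _); apply.
by rewrite mulrC ler_wpM2l// lerDl.
Qed.

Lemma continuous_marginal : continuous marginal.
Proof.
move=> x; apply/cvgrPdist_le => e e0.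
have [d d0 Hd] := Phi_uniform `|x| e0.
near=> x'.
rewrite /marginal -meanB; try exact/continuous_bounded_measurable/cPhi.
apply: ler_norm_mean_le => [|y y01].
  by apply: bounded_measurableB; exact/continuous_bounded_measurable/cPhi.
by apply: Hd => //; near: x'; exact: cvgr_dist_lt.
Unshelve. all: by end_near. Qed.

Let cPhi_diag m : continuous (fun x => Phi x (m%:R * x)).
Proof.
have c1 : continuous (fun x : R => W (m%:R * x)) by exact: continuous_scale.
have c2 : continuous (fun x : R => V ((n%:R + K%:R * m%:R) * x)).
  exact: continuous_scale.
rewrite /Phi; under eq_fun => x do rewrite mulrA -mulrDl.
by move=> x; apply: cvgM; [exact: c1|exact: c2].
Qed.

(** The first factor raises the degree to [d + m]. The second frequency is at least [2 m], as [K] is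
    at least 2, and [2 m - (d + m) = m - d] exceeds [N]. The absolute value forces [d < m] whatever
    the sign of [N]. *)
Lemma admissibleM f d m : (2 <= K)%N -> bounded_measurable (pnorm f) ->
  gapped N d f -> `|N| + d%:R + 1 < m%:R ->
  let g := fun x => f x * dilated_factor a m x * dilated_factor b (n + K * m) x in
  admissible g /\ forall x, pnorm g x = pnorm f x * Phi x (m%:R * x).
Proof.
move=> K2 bf gf Nm g.
have dm : (d < m)%N.
  by rewrite -(ltr_nat R); have := normr_ge0 N; lra.
have pg x : pnorm g x = pnorm f x * Phi x (m%:R * x).
  rewrite /pnorm /g !Normc.normcM !powRM ?mulr_ge0 ?normc_ge0// !normc_dilated_factor.
  by rewrite -mulrA /Phi /W /V natrD natrM mulrDl -(mulrA K%:R).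
split => //; split.
- exists (d + m + (n + K * m))%N; apply: gappedM; [apply: gappedM => //|..].
  + by rewrite (le_lt_trans _ Nm)//; have := ler_norm N; lra.
  + by case/andP : a01.
  + have Km : (2 * m <= n + K * m)%N by rewrite (leq_trans _ (leq_addl _ _))// leq_mul2r K2 orbT.
    have {}Km : 2 * m%:R <= (n + K * m)%:R :> R by rewrite -natrM ler_nat.
    by rewrite natrD; have := ler_norm N; lra.
  + by rewrite (@leq_trans (2 * m))//; [lia|nia].
  + by case/andP : b01.
- rewrite (_ : pnorm g = fun x => pnorm f x * Phi x (m%:R * x)); last exact/funext.
  apply: bounded_measurableM => //.
  exact: continuous_bounded_measurable.
Qed.

(** The limit given by [fejer_weight] is positive, so all large [m] give a positive integral, and
    [m] can also be taken large enough for [admissibleM]. *)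
Lemma weight_marginal : (2 <= K)%N -> weight marginal.
Proof.
move=> K2.
have bM : bounded_measurable marginal.
  exact/continuous_bounded_measurable/continuous_marginal.
split => // h f bh [[d gf] bf] hM.
have bhf : bounded_measurable (fun x => h x * pnorm f x) by exact: bounded_measurableM.
have : mean (fun x => h x * pnorm f x * Phi x (m%:R * x)) @[m --> \oo] -->
    mean (fun x => h x * pnorm f x * mean (Phi x)).
  apply: (@fejer_weight _ _ _ C) => //.
  - move=> x m y; rewrite /Phi /W powfactor_periodic; congr (_ * _).
    by rewrite mulrDr addrA -natrM /V powfactor_periodic.
  - move=> e e0; have [r r0 Hr] := Phi_uniform 1 e0.
    exists r => // x x' y x01 _ y01 xx'; apply: Hr => //.
    by rewrite ger0_norm//; case/andP: x01.
  - by move=> m; exact: continuous_bounded_measurable.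
move=> /cvgr_gt/(_ _ hM) lim.
have [m [Nm hm]] : exists m, `|N| + d%:R + 1 < m%:R /\
    0 < mean (fun x => h x * pnorm f x * Phi x (m%:R * x)).
  near \oo => m; exists m; split; near: m; last exact: lim.
  exact: nbhs_infty_gtr.
have [ag pg] := admissibleM K2 bf gf Nm.
exists (fun x => f x * dilated_factor a m x * dilated_factor b (n + K * m) x) => //.
by move: hm; congr (_ < _); apply: eq_mean => x _; rewrite pg mulrA.
Unshelve. all: by end_near. Qed.

End convolution.

End weights.

(** * Exponential limits and linearization of the kernel *)

Section exponential_limit.
Context {R : realType}.

(** The inverse of [expR_ge1Dx] at [- v / (1 + v)], where its lower bound is [1 / (1 + v)]. *)
Lemma expR_div_le (v : R) : -1 < v -> expR (v / (1 + v)) <= 1 + v.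
Proof.
move=> v1; have v0 : 0 < 1 + v by lra.
rewrite -[leRHS]invrK -[leLHS]invrK -expRN lef_pV2 ?posrE ?invr_gt0 ?expR_gt0//.
apply: le_trans (expR_ge1Dx _).
rewrite (_ : 1 + - (v / (1 + v)) = (1 + v)^-1)//; field; exact: lt0r_neq0.
Qed.

(** The power lies between the exponentials of [L v / (1 + v)] and [L v], which have the same
    limit. *)
Lemma cvg_expR_pow (v : nat -> R) (L : nat -> nat) (u : R) :
  v k @[k --> \oo] --> 0 -> (L k)%:R * v k @[k --> \oo] --> u ->
  (1 + v k) ^+ L k @[k --> \oo] --> expR u.
Proof.
move=> v0 Lv.
have v1 : (1 + v k)^-1 @[k --> \oo] --> (1 : R).
  rewrite -[X in _ --> X]invr1; apply: cvgV; first exact: oner_neq0.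
  by rewrite -[X in _ --> X]addr0; apply: cvgD => //; exact: cvg_cst.
apply: (@squeeze_cvgr _ _ _ _ (fun k => expR ((L k)%:R * v k * (1 + v k)^-1))
    (fun k => expR ((L k)%:R * v k))).
- have : \forall k \near \oo, - 1 < v k by apply: cvgr_gt; [exact: v0|rewrite ltrN10].
  apply: filterS => k vk; have v0' : 0 <= 1 + v k by lra.
  rewrite -mulrA !expRM_natl; apply/andP; split.
    by rewrite lerXn2r// ?nnegrE ?expR_ge0// expR_div_le.
  by rewrite lerXn2r// ?nnegrE ?expR_ge0// expR_ge1Dx.
- apply: continuous_cvg; first exact: continuous_expR.
  by rewrite -[X in _ --> X]mulr1; exact: cvgM.
- by apply: continuous_cvg; [exact: continuous_expR|].
Qed.

Lemma powR1D_linear (r e : R) : 0 < e -> exists2 d : R, 0 < d &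
  forall u, `|u| < d -> `|(1 + u) `^ r - 1 - r * u| <= e * `|u|.
Proof.
move=> e0.
have [D1 D2] := is_derive1_powR r (@ltr01 R).
move: D1; rewrite /derivable => /cvg_ex[l Hl].
have lr : l = r.
  by move: D2; rewrite /derive (cvg_lim (@Rhausdorff R) Hl) => ->; rewrite powR1 mulr1.
move: Hl; rewrite lr => /cvgrPdist_le/(_ _ e0)[d /= d0 Hd].
exists d => // u ud.
(* The limit of difference quotients says nothing at [u = 0]. *)
have [->|u0] := eqVneq u 0; first by rewrite addr0 powR1 !(mulr0, subrr) !normr0 mulr0.
have := Hd u; rewrite /= sub0r normrN => /(_ ud u0).
rewrite /GRing.scale/= mulr1 powR1 (addrC u 1) => Hu.
rewrite (_ : _ - _ = - u * (r - u^-1 * ((1 + u) `^ r - 1))); last first.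
  by rewrite mulrBr mulNr !mulNr mulrA mulfV// mul1r opprK; ring.
by rewrite normrM normrN mulrC ler_wpM2r.
Qed.

End exponential_limit.

Section linearization.
Context {R : realType}.
Variable p : R.
Hypothesis p_gt0 : 0 < p.

(** With [sqnorm = 1 + u] and [b < 1], one has [|u| <= 3 b], so the expansion of the power costs at
    most [(e / 6) 3 b = (e / 2) b]. The quadratic part [(p / 2) b^2] of [(p / 2) u] costs as much at
    most, because [b < e / p]. Nothing depends on [t]. *)
Lemma powfactor_linear (e : R) : 0 < e -> exists2 d : R, 0 < d &
  forall b t, 0 < b < d ->
    `|powfactor p b t - 1 - p * b * cos (2 * pi * t)| <= e * b.
Proof.
move=> e0.
have [d d0 Hd] := @powR1D_linear R (p / 2) (e / 6) (divr_gt0 e0 (ltr0n _ 6)).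
have ep : 0 < e / p by rewrite divr_gt0.
exists (Num.min (Num.min 1 (d / 3)) (e / p)).
  by rewrite !lt_min ltr01 ep divr_gt0.
move=> b t /andP[b0]; rewrite !lt_min => /andP[/andP[b1 bd] bep].
have c1 := cos_max (2 * pi * t); set c := cos _ in c1 *.
pose u := 2 * b * c + b ^+ 2.
have ub : `|u| <= 3 * b.
  rewrite (le_trans (ler_normD _ _))// normrX !normrM !(gtr0_norm b0).
  rewrite gtr0_norm//.
  have : b * `|c| <= b by rewrite ler_piMr// ltW.
  have : b ^+ 2 <= b by rewrite expr2 ler_piMr// ltW.
  lra.
have ud : `|u| < d by rewrite (le_lt_trans ub)//; lra.
have -> : powfactor p b t = (1 + u) `^ (p / 2).
  by rewrite /powfactor /sqnorm -addrA.
have Hu := Hd _ ud.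
have Eb : e / 6 * `|u| <= e / 2 * b.
  rewrite (@le_trans _ _ (e / 6 * (3 * b)))//; last by lra.
  by rewrite ler_wpM2l// divr_ge0// ltW.
have bb : p / 2 * b ^+ 2 <= e / 2 * b.
  rewrite expr2 mulrA ler_wpM2r ?ltW//.
  by move: bep; rewrite ltr_pdivlMr//; lra.
have bb0 : 0 <= p / 2 * b ^+ 2 by rewrite mulr_ge0 ?sqr_ge0// divr_ge0// ltW.
have eb0 : 0 <= e * b by rewrite mulr_ge0// ltW.
move: Hu Eb; rewrite !ler_norml => /andP[Hu1 Hu2] Eb.
have uE : p / 2 * u = p * b * c + p / 2 * b ^+ 2 by rewrite /u; field.
rewrite uE in Hu1 Hu2.
apply/andP; split; lra.
Qed.

Variables (N : R).
Hypothesis p_not_even : forall k : nat, p <> (2 * k)%:R.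

(** Only the cosine part of the addition formula survives, the kernel being even. *)
Lemma mean_cos_shift (a x : R) (n K : nat) : 0 <= a < 1 ->
  mean (fun y => powfactor p a y * cos (2 * pi * (n%:R * x + K%:R * y))) =
  fourier p a K * cos (2 * pi * (n%:R * x)).
Proof.
move=> a01.
have cs : continuous (fun y : R => powfactor p a y * sin (2 * pi * K%:R * y)).
  by move=> y; apply: cvgM; [exact: continuous_powfactor|exact: continuous_sin_scale].
have cc := @continuous_powfactor_cos R p a (2 * pi * K%:R) a01.
pose c1 := cos (2 * pi * (n%:R * x)); pose s1 := sin (2 * pi * (n%:R * x)).
transitivity (mean (fun y => c1 * (powfactor p a y * cos (2 * pi * K%:R * y)) -
    s1 * (powfactor p a y * sin (2 * pi * K%:R * y)))).
  by apply: eq_mean => y _; rewrite mulrDr cosD -/c1 -/s1 -[2 * pi * K%:R * y]mulrA; ring.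
rewrite meanB; try exact/bounded_measurableZ/continuous_bounded_measurable.
rewrite !meanZ; try exact/continuous_bounded_measurable.
by rewrite mean_powfactor_sin// mulr0 subr0 mulrC.
Qed.

(** [powfactor_linear] is integrated against [powfactor p a], whose mass [fourier p a 0] appears in
    the error. *)
Lemma marginal_linear (a : R) (n K : nat) (e : R) : 0 < a < 1 -> 0 < e ->
  exists2 d : R, 0 < d & forall b x, 0 < b < d ->
    `|marginal p a b n K x - fourier p a 0 -
      p * b * fourier p a K * cos (2 * pi * (n%:R * x))| <= e * b * fourier p a 0.
Proof.
move=> /andP[a0 a1] e0; have a01 : 0 <= a < 1 by rewrite ltW.
have [d d0 Hd] := powfactor_linear e0.
exists (Num.min d 1); first by rewrite lt_min d0 ltr01.
move=> b x; rewrite lt_min => /and3P[b0 bd b1].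
have b01 : 0 <= b < 1 by rewrite ltW.
pose phi (y : R) := n%:R * x + K%:R * y.
have cphi : continuous phi.
  by move=> y; apply: cvgD; [exact: cvg_cst|exact: mulrl_continuous].
have cW := @continuous_powfactor R p a a01.
have cc : continuous (fun y : R => cos (2 * pi * phi y)).
  have c2 : continuous (fun z : R => cos (2 * pi * z)) by exact: continuous_cos_scale.
  by move=> y; exact: (continuous_comp (cphi y) (c2 _)).
have cV : continuous (fun y : R => powfactor p b (phi y)).
  by move=> y; exact: (continuous_comp (cphi y) (@continuous_powfactor R p b b01 _)).
have bW := continuous_bounded_measurable cW.
have bc := continuous_bounded_measurable cc.
have bV := continuous_bounded_measurable cV.
rewrite fourier0E.
have -> : marginal p a b n K x - mean (powfactor p a) -
    p * b * fourier p a K * cos (2 * pi * (n%:R * x)) =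
    mean (fun y => powfactor p a y *
      (powfactor p b (phi y) - 1 - p * b * cos (2 * pi * phi y))).
  rewrite -(mulrA (p * b)) -mean_cos_shift// -meanZ; last exact: bounded_measurableM.
  rewrite /marginal -!meanB; last 4 first.
  - by apply: bounded_measurableB => //; exact: bounded_measurableM.
  - exact/bounded_measurableZ/bounded_measurableM.
  - exact: bounded_measurableM.
  - exact: bW.
  by apply: eq_mean => y _; rewrite /phi; ring.
have bD : bounded_measurable (fun y => powfactor p b (phi y) - 1 - p * b * cos (2 * pi * phi y)).
  apply: bounded_measurableB; last exact: bounded_measurableZ.
  by apply: bounded_measurableB => //; exact: bounded_measurable_cst.
rewrite (le_trans (ler_norm_mean _))//; first exact: bounded_measurableM.
rewrite -meanZ//; apply: ler_mean.
- exact/bounded_measurable_norm/bounded_measurableM.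
- exact: bounded_measurableZ.
move=> y _; rewrite normrM ger0_norm ?powR_ge0// mulrC ler_wpM2r ?powR_ge0//.
by apply: Hd; rewrite b0.
Qed.

End linearization.

(** * Exponential weights and indicators of cosine bands *)

Section cosine_weights.
Context {R : realType}.
Variables (N p : R).
Hypothesis p_gt0 : 0 < p.
Hypothesis p_not_even : forall k : nat, p <> (2 * k)%:R.

(** The weight is the limit of the powers [(M_b / c0)^L] with [b = r / L] and [L] tending to
    infinity; [K] is chosen so that [kappa] has the sign of [t]. *)
Lemma weight_expR_cos (n : nat) (t : R) :
  weight N p (fun x => expR (t * cos (2 * pi * (n%:R * x)))).
Proof.
have [->|t0] := eqVneq t 0.
  by under eq_fun do rewrite mul0r expR0; exact: weight1.
pose a : R := 2^-1.
have a01 : 0 < a < 1 by rewrite /a; apply/andP; split; lra.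
have a01' : 0 <= a < 1 by case/andP : a01 => /ltW -> ->.
have [K K2 tk] := fourier_sign p_gt0 p_not_even a01 t0.
pose c0 := fourier p a 0; pose kappa := fourier p a K.
have c0_gt0 : 0 < c0 by rewrite fourier0_gt0// ltW.
have kappa0 : kappa != 0 by apply: contraTneq (tk : 0 < t * kappa) => ->; rewrite mulr0 ltxx.
(* Chosen so that [p r kappa / c0 = t]; it is positive by the choice of [K]. *)
pose r := t * c0 / (p * kappa).
have r0 : 0 < r.
  have -> : r = t * kappa * (c0 / (p * kappa ^+ 2)).
    by rewrite /r; field; rewrite kappa0 gt_eqF.
  by rewrite mulr_gt0// divr_gt0// mulr_gt0// exprn_even_gt0.
have [d1 d10 Hd1] := marginal_linear p_gt0 n K a01 (@ltr01 R).
pose d := Num.min d1 1; have d0 : 0 < d by rewrite lt_min d10 ltr01.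
(* The offset gives [b k < d] for every [k], including 0. *)
pose L k := (k + (Num.truncn (r / d)).+1)%N.
have L0 k : 0 < (L k)%:R :> R by rewrite ltr0n /L addnS.
pose b k := r / (L k)%:R.
have b0 k : 0 < b k by rewrite divr_gt0.
have bd k : b k < d.
  rewrite ltr_pdivrMr// mulrC -ltr_pdivrMr// (lt_le_trans (truncnS_gt _))//.
  by rewrite ler_nat leq_addl.
have b01 k : 0 < b k < 1.
  by rewrite b0 (lt_le_trans (bd k))// ge_min lexx orbT.
pose v k x := c0^-1 * marginal p a (b k) n K x - 1.
(* Multiplication by [L k / c0] turns the main term of [marginal_linear] into [t cos] and its error
   into [e r]. *)
have key e k x : 0 < e ->
    `|marginal p a (b k) n K x - c0 - p * b k * kappa * cos (2 * pi * (n%:R * x))|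
      <= e * b k * c0 ->
    `|(L k)%:R * v k x - t * cos (2 * pi * (n%:R * x))| <= e * r.
  move=> e0 H.
  have Lc : 0 < (L k)%:R / c0 by rewrite divr_gt0.
  rewrite -(ler_pM2l Lc) in H.
  have Eb : (L k)%:R / c0 * (e * b k * c0) = e * r.
    by rewrite /b; field; rewrite !gt_eqF.
  rewrite Eb in H; move: H; rewrite -{1}(gtr0_norm Lc) -normrM.
  congr (`|_| <= _); rewrite /v /b /r.
  move: (marginal _ _ _ _ _ _) (cos _) => M c.
  by field; rewrite kappa0 !gt_eqF.
(* The case [e = 1] bounds the exponent uniformly, which gives the domination that [weight_cvg]
   needs. *)
have bound k x : (L k)%:R * v k x <= `|t| + r.
  have bk : 0 < b k < d1.
    by rewrite b0 (lt_le_trans (bd k))// ge_min lexx.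
  have := key 1 k x ltr01 (Hd1 (b k) x bk); rewrite mul1r => /(le_trans (ler_norm _)).
  have : t * cos (2 * pi * (n%:R * x)) <= `|t|.
    by rewrite (le_trans (ler_norm _))// normrM ler_piMr// cos_max.
  lra.
have v1 k x : 0 <= 1 + v k x.
  rewrite /v addrC subrK mulr_ge0 ?invr_ge0 ?(ltW c0_gt0)//.
  by apply: mean_ge0 => y _; rewrite mulr_ge0// powR_ge0.
have Lv x : (L k)%:R * v k x @[k --> \oo] --> t * cos (2 * pi * (n%:R * x)).
  apply/cvgrPdist_le => e e0.
  have er : 0 < e / r by rewrite divr_gt0.
  have [d2 d20 Hd2] := marginal_linear p_gt0 n K a01 er.
  near=> k; rewrite distrC.
  rewrite (_ : e = e / r * r); last by rewrite divfK// gt_eqF.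
  apply: key => //; apply: Hd2; rewrite b0/= ltr_pdivrMr// mulrC -ltr_pdivrMr//.
  have : r / d2 < k%:R by near: k; exact: nbhs_infty_gtr.
  by move=> /lt_le_trans; apply; rewrite ler_nat leq_addr.
have v0 x : v k x @[k --> \oo] --> 0.
  have -> : (fun k => v k x) = (fun k => ((L k)%:R)^-1 * ((L k)%:R * v k x)).
    by apply/funext => k; rewrite mulrA mulVf ?mul1r// gt_eqF.
  rewrite -[X in _ --> X](mul0r (t * cos (2 * pi * (n%:R * x)))).
  apply: cvgM; last exact: Lv.
  apply/cvgrPdist_le => e e0; near=> k.
  rewrite sub0r normrN gtr0_norm ?invr_gt0// -[e]invrK lef_pV2 ?posrE ?invr_gt0//.
  have : e^-1 < k%:R by near: k; exact: nbhs_infty_gtr.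
  by move=> /ltW/le_trans; apply; rewrite ler_nat leq_addr.
apply: (@weight_cvg R N p (fun k x => (1 + v k x) ^+ L k) _ (expR (`|t| + r))).
- move=> k; apply: weightX.
  have := weightZ _ (weight_marginal N p_gt0 a01 (b01 k) n K2).
  move=> /(_ c0^-1); rewrite invr_gt0 => /(_ c0_gt0).
  by congr weight; apply/funext => x; rewrite /v addrC subrK.
- move=> k x _; rewrite ger0_norm ?exprn_ge0//.
  apply: (@le_trans _ _ (expR (v k x) ^+ L k)).
    by rewrite lerXn2r// ?nnegrE ?expR_ge0// expR_ge1Dx.
  by rewrite -expRM_natl ler_expR.
- by move=> x; apply: cvg_expR_pow; [exact: v0|exact: Lv].
Unshelve. all: by end_near. Qed.

(** Each further factor [cos (2 pi x) - c] mixes the frequencies [n + 1], [n - 1] and [n]; sums in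
    the exponent are products of weights, and [t] of either sign is available. *)
Lemma weight_expR_cos_pow (c : R) (k n : nat) (t : R) :
  weight N p (fun x => expR (t * ((cos (2 * pi * x) - c) ^+ k *
                                 cos (2 * pi * (n%:R * x))))).
Proof.
elim: k n t => [|k IHk] n t.
  by under eq_fun do rewrite expr0 mul1r; exact: weight_expR_cos.
(* The index [n.-1 + (n == 0)] is [|n - 1|]: at [n = 0] the lower frequency is 1, cosine being
   even. *)
have prod (x : R) : cos (2 * pi * x) * cos (2 * pi * (n%:R * x)) =
    2^-1 * cos (2 * pi * (n.+1%:R * x)) + 2^-1 * cos (2 * pi * ((n.-1 + (n == 0))%:R * x)).
  pose A := 2 * pi * (n%:R * x); pose B := 2 * pi * x.
  have -> : 2 * pi * (n.+1%:R * x) = A + B by rewrite /A /B -natr1; ring.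
  have -> : cos (2 * pi * ((n.-1 + (n == 0))%:R * x)) = cos (A - B).
    rewrite /A /B; case: n {IHk A B} => [|n] /=.
      by rewrite add0n mul1r mul0r mulr0 sub0r cosN.
    by rewrite addn0 -natr1; congr cos; ring.
  by rewrite cosD cosB -/A -/B; field.
have := weightM (weightM (IHk n.+1 (t / 2)) (IHk (n.-1 + (n == 0))%N (t / 2)))
  (IHk n (- (t * c))).
congr weight; apply/funext => x; rewrite -!expRD; congr expR.
rewrite exprS.
transitivity (t * (cos (2 * pi * x) - c) ^+ k *
  (cos (2 * pi * x) * cos (2 * pi * (n%:R * x))) -
  t * c * (cos (2 * pi * x) - c) ^+ k * cos (2 * pi * (n%:R * x))); last by ring.
by rewrite prod; field.
Qed.

Lemma weight_expR_cos_even (c s t : R) (k : nat) :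
  weight N p (fun x => expR (- t * ((cos (2 * pi * x) - c) / s) ^+ k)).
Proof.
have := weight_expR_cos_pow c k 0 (- t / s ^+ k).
congr weight; apply/funext => x.
by rewrite !mul0r mulr0 cos0 mulr1 expr_div_n mulrAC mulrA.
Qed.

End cosine_weights.

Lemma expr_double_norm {R : realDomainType} (z : R) k :
  z ^+ k.*2 = `|z| ^+ k * `|z| ^+ k.
Proof. by rewrite -addnn exprD -!normrX -normrM ger0_norm// -expr2 sqr_ge0. Qed.

(** One of the two factors [|z|^k] absorbs [k]: from [|z| <= exp (- d)] and [k d <= exp (k d)]
    follows [k |z|^k <= 1 / d]. The other one tends to 0. *)
Lemma cvg_natM_expr {R : realType} (z : R) : `|z| < 1 ->
  k%:R * z ^+ k.*2 @[k --> \oo] --> 0.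
Proof.
move=> z1; pose d := 1 - `|z|; have d0 : 0 < d by rewrite subr_gt0.
apply: (@squeeze_cvgr _ _ _ _ (fun=> 0) (fun k => d^-1 * `|z| ^+ k)).
- near=> k; rewrite expr_double_norm mulrA.
  rewrite !mulr_ge0 ?exprn_ge0//= ler_wpM2r ?exprn_ge0//.
  rewrite -[leRHS]mul1r ler_pdivlMr// mulrAC.
  have zd : `|z| <= expR (- d) by rewrite (le_trans _ (expR_ge1Dx _))// /d; lra.
  apply: (@le_trans _ _ (k%:R * d * expR (- d) ^+ k)).
    by rewrite ler_wpM2l ?lerXn2r ?nnegrE ?expR_ge0// mulr_ge0// ltW.
  rewrite -expRM_natl mulrN expRN ler_pdivrMr ?expR_gt0// mul1r.
  by rewrite (le_trans _ (expR_ge1Dx _))// lerDr.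
- exact: cvg_cst.
- rewrite -[X in _ --> X](mulr0 d^-1); apply: cvgM; first exact: cvg_cst.
  by apply: cvg_expr; rewrite normr_id.
Unshelve. all: by end_near. Qed.

(** The functions [exp (- k z^(2 k))] tend to 1 inside the band, and are at most [exp (- k)]
    elsewhere. The factor [k] sends the boundary [|z| = 1] to 0 as well. *)
Lemma weight_band {R : realType} (N p c s : R) : 0 < p ->
  (forall k : nat, p <> (2 * k)%:R) -> 0 < s ->
  weight N p (fun x => (`|cos (2 * pi * x) - c| < s)%R%:R).
Proof.
move=> p0 pne s0.
pose z x : R := (cos (2 * pi * x) - c) / s.
have z2 x k : z x ^+ k.*2 = (z x ^+ k) ^+ 2 by rewrite -muln2 exprM.
apply: (@weight_cvg R N p (fun k x => expR (- k%:R * z x ^+ k.*2)) _ 1).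
- by move=> k; exact: weight_expR_cos_even.
- move=> k x _; rewrite ger0_norm ?expR_ge0// expR_le1 mulNr oppr_le0.
  by rewrite mulr_ge0// z2 sqr_ge0.
- move=> x; have -> : (`|cos (2 * pi * x) - c| < s) = (`|z x| < 1).
    by rewrite normrM normfV (gtr0_norm s0) ltr_pdivrMr// mul1r.
  have [z1|z1] := ltP `|z x| 1.
    rewrite /= -[X in _ --> X]expR0; apply: continuous_cvg; first exact: continuous_expR.
    under eq_fun do rewrite mulNr.
    by rewrite -oppr0; apply: cvgN; exact: cvg_natM_expr.
  apply: (@squeeze_cvgr _ _ _ _ (fun=> 0) (fun k => expR (- k%:R))).
  - near=> k; rewrite expR_ge0/= ler_expR mulNr lerN2 ler_peMr//.
    by rewrite expr_double_norm mulr_ege1 ?exprn_ege1.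
  - exact: cvg_cst.
  - exact: cvgn_expR.
Unshelve. all: by end_near. Qed.

(** * Borel subsets and density *)

Section measure.
Context {R : realType}.
Local Notation mu := (@lebesgue_measure R).
Local Notation cmu := (@completed_lebesgue_measure R).
(** Modulo 1 this is negation, in a form that preserves the unit interval. *)
Local Notation reflect A := ((fun x : R => 1 - x) @^-1` A).
Implicit Types (A B E : set R).

Lemma measurable_reflection : measurable_fun [set: R] (fun x : R => 1 - x).
Proof.
apply: continuous_measurable_fun => x.
by apply: cvgB; [exact: cvg_cst|exact: cvg_id].
Qed.

Lemma measurable_reflect A : measurable A -> measurable (reflect A).
Proof. by move=> mA; rewrite -[X in measurable X]setTI; exact: measurable_reflection. Qed.

(** The pushforward agrees with [mu] on half-open intervals, so uniqueness of Lebesgue measure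
    applies. *)
Lemma lebesgue_measure_reflect A : measurable A -> mu (reflect A) = mu A.
Proof.
move=> mA; rewrite -/(pushforward mu (fun x : R => 1 - x : measurableTypeR R) A).
apply/esym/lebesgue_measure_unique => //=.
  exact: measurable_reflection.
move=> _ _ [[a b]] _ <-; rewrite /pushforward.
rewrite (_ : _ @^-1` _ = `[1 - b, 1 - a[%classic); last first.
  apply/seteqP; split => x /=; rewrite !in_itv/= => /andP[h1 h2];
    by apply/andP; split; lra.
rewrite !lebesgue_measure_itv/= !lte_fin.
rewrite (_ : (1 - b < 1 - a) = (a < b)); last by rewrite ltrD2l ltrN2.
by case: ifP => // _; rewrite -!EFinB; congr EFin; ring.
Qed.

Lemma completed_measurable A : measurable A -> lebesgue_measurable A.
Proof. exact: sub_caratheodory. Qed.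

(** The identity, measurable from the Caratheodory to the Borel sigma-algebra, pushes [cmu] forward
    to [mu]. *)
Lemma completed_integralE A (f : R -> R) : measurable A ->
  measurable_fun [set: R] f -> (forall x, 0 <= f x) ->
  (\int[cmu]_(x in A) (f x)%:E = \int[mu]_(x in A) (f x)%:E)%E.
Proof.
move=> mA mf f0.
pose T := caratheodory_type ((wlength (@idfun R))^*)%mu.
have mid : measurable_fun [set: T] (fun x : T => x : measurableTypeR R).
  by move=> _ B mB; rewrite setTI; exact: completed_measurable.
rewrite -(@ge0_integral_pushforward _ _ T (measurableTypeR R) R _ mid cmu A (EFin \o f)) //.
  by apply/measurable_EFinP; exact: measurable_funTS.
by move=> x _; rewrite lee_fin; exact: f0.
Qed.

(** A Lebesgue measurable set is a Borel set up to a negligible one, so the Borel part carries the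
    measure. *)
Lemma positive_borel_subset E : lebesgue_measurable E -> (0 < cmu E)%E ->
  exists B, [/\ measurable B, B `<=` E & (0 < mu B)%E].
Proof.
rewrite /lebesgue_measurable -completed_caratheodory_measurable.
rewrite g_sigma_completed_algebra_genE => -[B mB [Z negZ <-]] BZ.
exists B; split => //; rewrite lt_neqAle measure_ge0 andbT; apply/eqP => B0.
have Z0 : cmu Z = 0%E by exact/negligible_outer_measure.
have B0' : cmu B = 0%E by exact: esym B0.
have : (cmu (B `|` Z) <= cmu B + cmu Z)%E by exact: outer_measureU2.
by rewrite Z0 B0' adde0 leNgt BZ.
Qed.

(** [E] is stable under reflection on the circle, so a Borel part of it folds onto the left half.
    Were the folded set null, that part would be covered by it, its mirror image and the points 0
    and 1/2, a null set. *)
Lemma half_circle_subset E : circle_set E -> symmetric_set E ->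
  lebesgue_measurable E -> (0 < circle_measure E)%E ->
  exists B, [/\ measurable B, B `<=` `]0, 2^-1[,
    B `|` reflect B `<=` E & (0 < mu B)%E].
Proof.
move=> cE sE mE E0.
have rE x : E (1 - x) -> E x.
  by move=> /sE; rewrite opprB => /cE; rewrite subrK.
have [|B [mB BE B0]] := positive_borel_subset _ E0.
  apply: measurableI => //; apply: completed_measurable; exact: measurable_itv.
pose B1 := (B `|` reflect B) `&` `]0, 2^-1[.
have mB1 : measurable B1.
  apply: measurableI; last exact: measurable_itv.
  by apply: measurableU => //; exact: measurable_reflect.
have B1E : B1 `<=` E by move=> x [[/BE[]//|/BE[/rE]]].
exists B1; split => //.
- by move=> x [].
- by move=> x [/B1E//|/B1E/rE].
rewrite lt_neqAle measure_ge0 andbT; apply/eqP => /esym B10.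
suff : mu.-negligible B.
  by move=> /(negligibleP mu mB) B0'; rewrite B0' ltxx in B0.
have : mu.-negligible (B1 `|` reflect B1 `|` [set 0] `|` [set 2^-1]).
  apply: negligibleU; [apply: negligibleU; [apply: negligibleU|]|].
  - exact/negligibleP.
  - apply/negligibleP; first exact: measurable_reflect.
    by rewrite -B10; exact: lebesgue_measure_reflect.
  - by apply/negligibleP => //; exact: lebesgue_measure_set1.
  - by apply/negligibleP => //; exact: lebesgue_measure_set1.
apply: negligibleS => x Bx; have [_] := BE _ Bx; rewrite /= in_itv/= => /andP[x0 x1].
have [->|x0'] := eqVneq x 0; first by left; right.
have [->|x2] := eqVneq x 2^-1; first by right.
left; left; have [xh|xh] := ltP x 2^-1.
  by left; split; [left|rewrite /= in_itv/= lt_neqAle eq_sym x0' x0].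
right; split; first by right; rewrite /= subKr.
have : 2^-1 < x by rewrite lt_neqAle eq_sym x2.
by rewrite /= in_itv/= => h; apply/andP; split; lra.
Qed.

(** The interval is a small ball around a Lebesgue density point of [B]. *)
Lemma dense_interval B (gamma : R) : measurable B -> B `<=` `]0, 2^-1[ ->
  (0 < mu B)%E -> gamma < 1 -> exists u v : R,
    [/\ 0 < u, u < v, v < 2^-1 & gamma * (v - u) < fine (mu (B `&` `]u, v[))].
Proof.
move=> mB B12 B0 g1.
have [x [Bx]] : exists x, B x /\
    (mu (B `&` ball x r) * (mu (ball x r))^-1)%E @[r --> 0^'+] --> (\1_B x)%:E.
  apply: contrapT => nx; have := lebesgue_density mB.
  move=> /negligibleS -/(_ B) nB.
  have : mu.-negligible B by apply: nB => x Bx /= cx; apply: nx; exists x.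
  by move=> /(negligibleP mu mB) B0'; rewrite B0' ltxx in B0.
have := B12 _ Bx; rewrite /= in_itv/= => /andP[x0 x2].
rewrite indicE mem_set//= => cx.
have g1' : (gamma%:E < 1%:E)%E by rewrite lte_fin.
have [r [r0 rx rx2 gr]] : exists r : R, [/\ 0 < r, r < x, r < 2^-1 - x &
    (gamma%:E < mu (B `&` ball x r) * (mu (ball x r))^-1)%E].
  near ((0 : R)^'+) => r; exists r; split; near: r.
  - exact: nbhs_right_gt.
  - exact: nbhs_right_lt.
  - by apply: nbhs_right_lt; rewrite subr_gt0.
  - exact: (cx _ (open_ereal_gt' g1')).
exists (x - r), (x + r); split; [lra|lra|lra|].
move: gr; rewrite lebesgue_measure_ball ?ltW// ball_itv.
set m := mu _; have mfin : m \is a fin_num.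
  rewrite ge0_fin_numE ?measure_ge0// (@le_lt_trans _ _ (mu `]x - r, x + r[))//.
    by rewrite le_measure ?inE//; apply: measurableI.
  by rewrite lebesgue_measure_itv/=; case: ifP => _; rewrite -?EFinB ltry.
rewrite -(fineK mfin) inver mulrn_eq0/= gt_eqF// -EFinM lte_fin.
rewrite ltr_pdivlMr ?mulrn_wgt0//.
by congr (_ < _); congr (_ * _); ring.
Unshelve. all: by end_near. Qed.

Lemma mean_indic A : measurable A -> A `<=` `[0, 1] -> mean \1_A = fine (mu A).
Proof.
move=> mA A01; rewrite /mean /Rintegral integral_indic//=.
by rewrite setIidl.
Qed.

End measure.

(** * Concentration on an interval and its mirror image *)

Section concentration.
Context {R : realType}.
Local Notation mu := (@lebesgue_measure R).
Local Notation cmu := (@completed_lebesgue_measure R).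
Local Notation reflect A := ((fun x : R => 1 - x) @^-1` A).

(** Cosine is strictly decreasing on the left half, where the band is []u, v[]; reflection brings
    the right half there. *)
Lemma cos_band (u v x : R) : 0 < u -> u < v -> v < 2^-1 -> 0 <= x <= 1 ->
  (`|cos (2 * pi * x) - (cos (2 * pi * u) + cos (2 * pi * v)) / 2| <
    (cos (2 * pi * u) - cos (2 * pi * v)) / 2) =
  (u < x < v) || (u < 1 - x < v).
Proof.
move=> u0 uv v2 /andP[x0 x1].
have pi0 := @pi_gt0 R.
set U := cos (2 * pi * u); set V := cos (2 * pi * v).
have -> y : (`|y - (U + V) / 2| < (U - V) / 2) = (V < y < U).
  by rewrite ltr_norml; apply/andP/andP => -[? ?]; split; lra.
have mono (y z : R) : 0 <= y <= 2^-1 -> 0 <= z <= 2^-1 ->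
    (cos (2 * pi * z) < cos (2 * pi * y)) = (y < z).
  move=> y2 z2; rewrite ltr_cos ?ltr_pM2l ?mulr_gt0// in_itv/=.
    by case/andP: z2 => ? ?; apply/andP; split; nra.
  by case/andP: y2 => ? ?; apply/andP; split; nra.
have u2 : 0 <= u <= 2^-1 by apply/andP; split; lra.
have v2' : 0 <= v <= 2^-1 by apply/andP; split; lra.
have [xh|xh] := lerP x 2^-1.
  have x2 : 0 <= x <= 2^-1 by rewrite x0.
  rewrite !mono//; rewrite andbC; case: (_ && _) => //=.
  by apply/esym/negbTE; rewrite negb_and -!leNgt; apply/orP; right; lra.
have x2 : 0 <= 1 - x <= 2^-1 by apply/andP; split; lra.
have -> : cos (2 * pi * x) = cos (2 * pi * (1 - x)).
  by rewrite -[LHS]cosN -mulrN -(cos2pi_periodic 1 (- x)) addrC.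
rewrite !mono//; rewrite andbC; case: (_ && _) => //=; first by rewrite orbT.
by apply/esym/negbTE; rewrite orbF negb_and -!leNgt; apply/orP; right; lra.
Qed.

Lemma admissible1 (N p : R) : admissible N p (fun=> 1).
Proof.
split; first by exists 0%N; exact: gapped1.
rewrite /pnorm; exact: bounded_measurable_cst.
Qed.

(** The band weight is tested on the constant polynomial 1 with [h = \1_S - gamma]; density of [B]
    in []u, v[] makes the integral positive. *)
Lemma concentration_mean (p gamma N : R) (B : set R) : 0 < p ->
  (forall k : nat, p <> (2 * k)%:R) -> gamma < 1 ->
  measurable B -> B `<=` `]0, 2^-1[ -> (0 < mu B)%E ->
  exists2 f, admissible N p f &
    0 < mean (fun x => (\1_(B `|` reflect B) x - gamma) * pnorm p f x).
Proof.
move=> p0 pne g1 mB B2 B0.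
have [u [v [u0 uv v2 dens]]] := dense_interval mB B2 B0 g1.
pose c := (cos (2 * pi * u) + cos (2 * pi * v)) / 2.
pose s := (cos (2 * pi * u) - cos (2 * pi * v)) / 2.
have pi0 := @pi_gt0 R.
have s0 : 0 < s.
  rewrite divr_gt0// subr_gt0 ltr_cos ?ltr_pM2l ?mulr_gt0// in_itv/=;
    by apply/andP; split; nra.
have [bw Hw] := weight_band N c p0 pne s0.
set w := (fun x => _) in bw Hw.
pose I : set R := `]u, v[%classic; pose S := B `|` reflect B.
have mI : measurable I by exact: measurable_itv.
have mBI : measurable (B `&` I) by exact: measurableI.
have I01 : I `<=` `[0, 1].
  by move=> x; rewrite /I /= !in_itv/= => /andP[? ?]; apply/andP; split; lra.
have r01 A : A `<=` I -> reflect A `<=` `[0, 1].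
  by move=> AI x /= /AI; rewrite /I /= !in_itv/= => /andP[? ?]; apply/andP; split; lra.
have mS : measurable S by apply: measurableU => //; exact: measurable_reflect.
have bS : bounded_measurable (fun x => \1_S x - gamma).
  by apply: bounded_measurableB; 
    [exact: bounded_measurable_indic|exact: bounded_measurable_cst].
have b1 := bounded_measurable_indic mBI.
have b2 := bounded_measurable_indic (measurable_reflect mBI).
have b3 := bounded_measurable_indic mI.
have b4 := bounded_measurable_indic (measurable_reflect mI).
apply: (Hw (fun x => \1_S x - gamma) (fun=> 1) bS (admissible1 N p)).
(* Only [B] in the interval and its mirror image are kept from [S]; the mean of this lower bound is
   twice [mu (B & I) - gamma (v - u)]. *)
apply: (@lt_le_trans _ _ (mean (fun x => (\1_(B `&` I) x + \1_(reflect (B `&` I)) x) -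
    gamma * (\1_I x + \1_(reflect I) x)))).
  rewrite meanB; [|exact: bounded_measurableD|exact/bounded_measurableZ/bounded_measurableD].
  rewrite meanZ; last exact: bounded_measurableD.
  rewrite !meanD// !mean_indic//; try exact: measurable_reflect.
  - have muI : mu I = (v - u)%:E.
      by rewrite /I lebesgue_measure_itv/= lte_fin uv EFinB.
    rewrite !lebesgue_measure_reflect//= muI/=.
    move: dens; rewrite -/I; move: (fine _) => m; lra.
  - exact: r01.
  - by apply: r01 => x [].
  - by move=> x [_ /I01].
apply: ler_mean.
- apply: bounded_measurableB; first exact: bounded_measurableD.
  exact/bounded_measurableZ/bounded_measurableD.
- apply: bounded_measurableM => //; apply: bounded_measurableM => //.
  exact: (admissible1 N p).2.
move=> x x01; rewrite /w cos_band// /pnorm Normc.normc1 powR1 mulr1 !indicE.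
have memI y : (y \in I) = (u < y < v) by rewrite mem_setE in_itv.
have memr (A : set R) : (x \in reflect A) = (1 - x \in A).
  by apply/idP/idP; rewrite !inE.
rewrite !memr !in_setI !in_setU memr !memI.
case: (boolP (u < x < v)) => [/andP[ux xv]|_]; rewrite ?andbF ?andbT ?orbF /=.
  (* The interval and its mirror image are disjoint because [v < 1/2]. *)
  have -> : (u < 1 - x < v) = false.
    by apply/negbTE; rewrite negb_and -!leNgt; apply/orP; right; lra.
  rewrite andbF /=.
  by case: (x \in B); case: (1 - x \in B) => /=; lra.
case: (u < 1 - x < v); rewrite ?andbF ?andbT /=.
  by case: (x \in B); case: (1 - x \in B) => /=; lra.
by lra.
Qed.

Lemma circle_integral_mean (S : set R) (g : R -> R) : measurable S ->
  bounded_measurable g -> (forall x, 0 <= g x) ->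
  circle_integral S g = (mean (fun x => \1_S x * g x))%:E.
Proof.
move=> mS bg g0; have mg := bg.1.
have mI : measurable (`[0, 1[%classic : set R) by exact: measurable_itv.
rewrite /circle_integral completed_integralE//; last exact: measurableI.
have bSg : bounded_measurable (fun x => \1_S x * g x).
  by apply: bounded_measurableM => //; exact: bounded_measurable_indic.
rewrite integral_mkcondl.
rewrite (_ : (fun x => (g x)%:E) \_ S = fun x => (\1_S x * g x)%:E); last first.
  apply/funext => x; rewrite patchE indicE.
  by case: (x \in S); rewrite ?mul1r ?mul0r.
rewrite integral_itv_bndo_bndc; last first.
  by apply/measurable_EFinP; apply: measurable_funTS; exact: bSg.1.
rewrite /mean /Rintegral fineK//.
exact/integrable_fin_num/bounded_measurable_integrable.
Qed.

Lemma circle_integral_le (S E : set R) (g : R -> R) : measurable S ->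
  lebesgue_measurable E -> S `<=` E -> measurable_fun [set: R] g ->
  (forall x, 0 <= g x) -> (circle_integral S g <= circle_integral E g)%E.
Proof.
move=> mS mE SE mg g0.
have mI : lebesgue_measurable (`[0, 1[%classic : set R).
  by apply: completed_measurable; exact: measurable_itv.
apply: ge0_subset_integral.
- by apply: measurableI => //; exact: completed_measurable.
- exact: measurableI.
- apply: measurable_funTS; apply/measurable_EFinP => _ A mA; rewrite setTI.
  by apply: completed_measurable; rewrite -[X in measurable X]setTI; exact: mg.
- by move=> x _; rewrite lee_fin.
- exact: setSI.
Qed.

End concentration.

Unset Implicit Arguments.

Theorem theorem50 (R : realType) (p : R) (p_gt0 : 0 < p)
    (p_not_even : forall k : nat, p <> (2 * k)%:R) :
  forall gamma : R, gamma < 1 ->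
  forall E : set R, circle_set E -> symmetric_set E -> lebesgue_measurable E ->
    (0 < circle_measure E)%E ->
  forall N : R, 0 < N ->
  exists f : R -> R[i],
    [/\ Pplus f, gaps_larger_than N f
      & (gamma%:E * circle_integral setT (fun x => Normc.normc (f x) `^ p)%R
         <= circle_integral E (fun x => Normc.normc (f x) `^ p)%R)%E].
Proof.
move=> gamma gamma1 E cE sE mE E0 N _.
have [B [mB B2 BE B0]] := half_circle_subset cE sE mE E0.
have [f [[d gf] bf] hf] := concentration_mean N p_gt0 p_not_even gamma1 mB B2 B0.
exists f; split; [exact: gapped_Pplus gf|exact: gapped_gaps gf|].
have mS : measurable (B `|` (fun x => 1 - x) @^-1` B).
  by apply: measurableU => //; exact: measurable_reflect.
have bS := bounded_measurable_indic mS.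
have pf0 x : 0 <= pnorm p f x by exact: powR_ge0.
(* Passing from [E] to a Borel subset can only lower the integral, which then becomes a [mean]. *)
apply: le_trans (circle_integral_le mS mE BE bf.1 pf0).
rewrite !circle_integral_mean// -EFinM lee_fin -meanZ; last first.
  by apply: bounded_measurableM => //; rewrite indicT; exact: bounded_measurable_cst.
rewrite -subr_ge0 -meanB; last 2 first.
- exact: bounded_measurableM.
- apply/bounded_measurableZ/bounded_measurableM => //.
  by rewrite indicT; exact: bounded_measurable_cst.
apply: ltW; move: hf; congr (_ < _); apply: eq_mean => x _.
by rewrite indicT /= mul1r -/(pnorm p f x) mulrBl.
Qed.
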